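(* Let $(\mathfrak{A},\{\mu_k\}_{k=1}^\infty)$ be an $A_\infty$-algebra. Then there is an $L_\infty$-algebra $$\Big(\mathcal{H}=\bigoplus_{n\in\mathbb{Z}}C^n(\overline{\mathfrak{A}},\mathfrak{A}),\ \{l_k\}_{k=1}^\infty\Big)$$ with the structure maps given by $$l_k(f_1,\ldots,f_k):=P[\cdots[[\pi,f_1],f_2],\ldots,f_k],$$ for any $k\ge 1$ and homogeneous elements $f_1,\ldots,f_k\in\mathcal{H}$, where $\overline{\mathfrak{A}}$, $C^n$, $P$, $\pi$ and the bracket $[\,,\,]$ are as defined in the context.
   Context: All graded vector spaces are over a field $\mathbf{k}$ of characteristic $0$. **$A_\infty$-algebras (shifted convention).** An $A_\infty$-algebra is a graded vector space $\mathfrak{A}=\oplus_{i\in\mathbb{Z}}\mathfrak{A}_i$ with degree $-1$ graded linear maps $\mu_k:\mathfrak{A}^{\otimes k}\to\mathfrak{A}$ ($k\ge1$) such that for each $n\ge1$ and homogeneous $a_1,\ldots,a_n$, $$\sum_{k+l=n+1}\sum_{i=1}^{n-l+1}(-1)^{|a_1|+\cdots+|a_{i-1}|}\mu_k(a_1,\ldots,a_{i-1},\mu_l(a_i,\ldots,a_{i+l-1}),a_{i+l},\ldots,a_n)=0.$$ **$L_\infty$-algebras (shifted convention).** An $L_\infty$-algebra is a graded vector space $\mathfrak{L}=\oplus_{i\in\mathbb{Z}}\mathfrak{L}_i$ with degree $-1$ graded symmetric linear maps $l_k:\mathfrak{L}^{\otimes k}\to\mathfrak{L}$ ($k\ge 1$)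 such that for each $n\ge1$ and homogeneous $x_1,\ldots,x_n$, $$\sum_{i+j=n+1}\ \sum_{\sigma\in\mathbb{S}_{(i,n-i)}}\epsilon(\sigma)\,l_j\big(l_i(x_{\sigma(1)},\ldots,x_{\sigma(i)}),x_{\sigma(i+1)},\ldots,x_{\sigma(n)}\big)=0,$$ where $\mathbb{S}_{(i,n-i)}$ is the set of $(i,n-i)$-shuffles and $\epsilon(\sigma)$ is the Koszul sign. **The graded Lie algebra.** For graded vector spaces $V,W$, let $\overline{T}(V)=\oplus_{n\ge1}V^{\otimes n}$ and let $C^n(V,W)=\mathrm{Hom}^n(\overline{T}(V),W)$ be the space of degree $n$ graded linear maps; an element is a formal sum $\mu=\sum_{k\ge1}\mu_k$ with $\mu_k:V^{\otimes k}\to W$ of degree $n$. On $\oplus_{n}C^n(V,V)$ there is a graded Lie bracket: for $\mu=\sum_k\mu_k\in C^n(V,V)$ and $\nu=\sum_l\nu_l\in C^m(V,V)$, $$[\mu,\nu]=\sum_{p\ge1}\Big(\sum_{k+l=p+1}\mu_k\diamond\nu_l-(-1)^{mn}\nu_l\diamond\mu_k\Big),$$ $$(\mu_k\diamond\nu_l)(a_1,\ldots,a_p)=\sum_{i=1}^{p-l+1}(-1)^{m(|a_1|+\cdots+|a_{i-1}|)}\mu_k(a_1,\ldots,a_{i-1},\nu_l(a_i,\ldots,a_{i+l-1}),a_{i+l},\ldots,a_p),$$ where $m$ is the degree of $\nu_l$ (and analogously for $\nu_l\diamond\mu_k$, with $m$ replaced by the degree $n$ of $\mu_k$). **The data $\mathcal{G},\mathcal{H},P,\pi$.**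 Given an $A_\infty$-algebra $(\mathfrak{A},\{\mu_k\})$, let $\overline{\mathfrak{A}}$ be another copy of $\mathfrak{A}$, the copy of $a\in\mathfrak{A}$ being denoted $\overline{a}$. Let $\mathcal{G}=\big(\oplus_{n\in\mathbb{Z}}C^n(\overline{\mathfrak{A}}\oplus\mathfrak{A},\overline{\mathfrak{A}}\oplus\mathfrak{A}),[\,,\,]\big)$ be the graded Lie algebra $\big(\oplus_{n\in\mathbb{Z}}C^n(V,V),[\,,\,]\big)$ for $V=\overline{\mathfrak{A}}\oplus\mathfrak{A}$, with bracket $[\mu,\nu]=\sum_{p\ge1}\big(\sum_{k+l=p+1}\mu_k\diamond\nu_l-(-1)^{mn}\nu_l\diamond\mu_k\big)$ for $\mu=\sum_k\mu_k\in C^n(V,V)$ and $\nu=\sum_l\nu_l\in C^m(V,V)$. Regard $\mathcal{H}=\oplus_{n\in\mathbb{Z}}C^n(\overline{\mathfrak{A}},\mathfrak{A})$ as a graded subspace of $\mathcal{G}$ (extend $f_k:\overline{\mathfrak{A}}^{\otimes k}\to\mathfrak{A}$ by $((\overline{a_1},x_1),\ldots,(\overline{a_k},x_k))\mapsto(0,f_k(\overline{a_1},\ldots,\overline{a_k}))$). Let $P:\mathcal{G}\to\mathcal{H}$ be the projection (restrict inputs to $\overline{\mathfrak{A}}$ and project the output onto $\mathfrak{A}$). Let $\pi=\sum_{k\ge1}\widetilde{\mu_k}\in\mathcal{G}_{-1}$, where $$\widetilde{\mu_k}\big((\overline{a_1},x_1),\ldots,(\overline{a_k},x_k)\big)=\Big(\overline{\mu_k(a_1,\ldots,a_k)}\,,\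 \sum_{p=1}^k\ \sum_{1\le i_1<\cdots<i_p\le k}\mu_k(a_1,\ldots,x_{i_1},\ldots,x_{i_p},\ldots,a_k)\Big),$$ the $(i_1,\ldots,i_p)$-summand being obtained from $\mu_k(a_1,\ldots,a_k)$ by replacing $a_{i_1},\ldots,a_{i_p}$ with $x_{i_1},\ldots,x_{i_p}$. *)

(* Defs.v *)
From HB Require Import structures.
From mathcomp Require Import all_boot all_order all_fingroup all_algebra.
From mathcomp Require Import boolp classical_sets functions.
From mathcomp Require Import ring zify.

Set Implicit Arguments.
Unset Strict Implicit.
Unset Printing Implicit Defensive.

Import GRing.Theory.
Local Open Scope ring_scope.

(** * Graded vector spaces *)

(* A Z-graded vector space is given by its total space V = (+)_d V_d together
   with the homogeneous subspaces: [homog d v] means v \in V_d.  Zero is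
   homogeneous of every degree. *)
HB.mixin Record isGraded (K : fieldType) V of GRing.Lmodule K V := {
  homog : int -> V -> Prop;
  homog0 : forall d, homog d 0;
  homogP : forall d (a : K) u v,
    homog d u -> homog d v -> homog d (a *: u + v);
  homog_span : forall v, exists s : seq (int * V),
    (forall p, p \in s -> homog p.1 p.2) /\ v = \sum_(p <- s) p.2;
  homog_indep : forall (s : seq int) (c : int -> V), uniq s ->
    (forall d, homog d (c d)) -> \sum_(d <- s) c d = 0 ->
    forall d, d \in s -> c d = 0
}.

#[short(type="gradedLmodType")]
HB.structure Definition GradedLmodule (K : fieldType) :=
  {V of GRing.Lmodule K V & isGraded K V}.

Section GradedTheory.
Variables (K : fieldType) (V : gradedLmodType K).
Implicit Types (u v : V) (d e : int) (s t : seq V).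

Lemma homogZ d (a : K) v : homog d v -> homog d (a *: v).
Proof. by move=> hv; rewrite -[_ *: _]addr0; apply: homogP => //; apply: homog0. Qed.

Lemma homogD d u v : homog d u -> homog d v -> homog d (u + v).
Proof. by move=> hu hv; rewrite -[u]scale1r; apply: homogP. Qed.

Lemma homogB d u v : homog d u -> homog d v -> homog d (u - v).
Proof. by move=> hu hv; rewrite addrC -scaleN1r; apply: homogP. Qed.

Lemma homog_sum d (I : eqType) (r : seq I) (P : pred I) (F : I -> V) :
  (forall i, i \in r -> P i -> homog d (F i)) ->
  homog d (\sum_(i <- r | P i) F i).
Proof.
move=> h; rewrite big_seq_cond; elim/big_ind: _ => [|x y|i /andP[]].
- exact: homog0.
- exact: homogD.
- exact: h.
Qed.

Lemma sum_by_degree (U : zmodType) (s : seq (int * U)) :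
  \sum_(p <- s) p.2 =
  \sum_(d <- undup [seq p.1 | p <- s]) \sum_(p <- s | p.1 == d) p.2.
Proof.
under [RHS]eq_bigr do rewrite big_mkcond.
rewrite exchange_big /= big_seq [RHS]big_seq; apply: eq_bigr => p ps.
rewrite (bigD1_seq p.1) ?undup_uniq ?mem_undup ?map_f //= eqxx.
by rewrite big1 ?addr0 // => d /negbTE; rewrite eq_sym => ->.
Qed.

Lemma decomp_ex v : exists sc : seq int * (int -> V),
  [/\ uniq sc.1, (forall d, homog d (sc.2 d)),
      (forall d, d \notin sc.1 -> sc.2 d = 0)
    & v = \sum_(d <- sc.1) sc.2 d].
Proof.
have [s [hs ->]] := homog_span v.
exists (undup [seq p.1 | p <- s], fun d => \sum_(p <- s | p.1 == d) p.2) => /=.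
split; first exact: undup_uniq.
- by move=> d; apply: homog_sum => p ps /eqP <-; apply: hs.
- move=> d; rewrite mem_undup => dN; rewrite big_seq_cond big1 // => p /andP[ps].
  by move=> /eqP pd; case/negP: dN; rewrite -pd map_f.
- exact: sum_by_degree.
Qed.

(* The degrees in which v has a nonzero component all belong to [gsupp v], and
   [gcomp d v] is the component of v in V_d. *)
Definition gsupp v : seq int := (projT1 (cid (decomp_ex v))).1.
Definition gcomp d v : V := (projT1 (cid (decomp_ex v))).2 d.

Lemma gsupp_uniq v : uniq (gsupp v).
Proof. by rewrite /gsupp; case: cid => sc []. Qed.

Lemma gcomp_homog d v : homog d (gcomp d v).
Proof. by rewrite /gcomp; case: cid => sc []. Qed.

Lemma gcomp_supp d v : d \notin gsupp v -> gcomp d v = 0.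
Proof. by rewrite /gcomp /gsupp; case: cid => sc [] ? ? h ?; apply: h. Qed.

Lemma gcomp_sum v : \sum_(d <- gsupp v) gcomp d v = v.
Proof. by rewrite /gcomp /gsupp; case: cid => sc []. Qed.

Lemma big_undup_supp (U : zmodType) (r t : seq int) (F : int -> U) :
  uniq r -> uniq t -> {subset r <= t} ->
  (forall d, d \notin r -> F d = 0) ->
  \sum_(d <- r) F d = \sum_(d <- t) F d.
Proof.
move=> ur ut rt F0; rewrite [RHS](bigID (mem r)) /=.
rewrite [X in _ = _ + X]big1 ?addr0 => [|d /F0 //].
rewrite -[RHS]big_filter; apply: perm_big; apply: uniq_perm => //.
  exact: filter_uniq.
move=> d; rewrite mem_filter; case: (boolP (d \in r)) => //= dr.
by rewrite rt.
Qed.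

Lemma gcomp_uniq (s : seq int) (c : int -> V) v : uniq s ->
  (forall d, homog d (c d)) -> (forall d, d \notin s -> c d = 0) ->
  v = \sum_(d <- s) c d -> forall d, gcomp d v = c d.
Proof.
move=> us hc c0 vE d; apply/eqP; rewrite -subr_eq0; apply/eqP.
set t := undup (s ++ gsupp v).
have [dt|] := boolP (d \in t); last first.
  rewrite mem_undup mem_cat negb_or => /andP[ds dv].
  by rewrite gcomp_supp // c0 // subrr.
apply: (@homog_indep K V t (fun d => gcomp d v - c d)) => //.
- exact: undup_uniq.
- by move=> e; apply: homogB => //; apply: gcomp_homog.
rewrite big_split /= sumrN.
have tE (r : seq int) (F : int -> V) : uniq r -> {subset r <= t} ->
    (forall d, d \notin r -> F d = 0) -> \sum_(d <- t) F d = \sum_(d <- r) F d.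
  by move=> *; apply/esym/big_undup_supp => //; apply: undup_uniq.
rewrite (tE (gsupp v)) ?gsupp_uniq //; first rewrite (tE s) //.
- by rewrite gcomp_sum -vE subrr.
- by move=> e es; rewrite mem_undup mem_cat es.
- by move=> e ev; rewrite mem_undup mem_cat ev orbT.
- by move=> e; apply: gcomp_supp.
Qed.

Lemma gcomp_is_linear d (a : K) u v :
  gcomp d (a *: u + v) = a *: gcomp d u + gcomp d v.
Proof.
apply: (@gcomp_uniq (undup (gsupp u ++ gsupp v))
         (fun d => a *: gcomp d u + gcomp d v)).
- exact: undup_uniq.
- by move=> e; apply: homogP; apply: gcomp_homog.
- move=> e; rewrite mem_undup mem_cat negb_or => /andP[eu ev].
  by rewrite !gcomp_supp // scaler0 addr0.
rewrite big_split /= -scaler_sumr; congr (_ *: _ + _).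
- rewrite -(@big_undup_supp _ (gsupp u)) ?gcomp_sum ?gsupp_uniq ?undup_uniq //.
    by move=> e eu; rewrite mem_undup mem_cat eu.
  by move=> e; apply: gcomp_supp.
- rewrite -(@big_undup_supp _ (gsupp v)) ?gcomp_sum ?gsupp_uniq ?undup_uniq //.
    by move=> e eu; rewrite mem_undup mem_cat eu orbT.
  by move=> e; apply: gcomp_supp.
Qed.

Lemma gcomp_of_homog d e v : homog e v -> gcomp d v = if d == e then v else 0.
Proof.
move=> hv; apply: (@gcomp_uniq [:: e] (fun d => if d == e then v else 0)) => //.
- by move=> f; case: eqP => [->|_] //; apply: homog0.
- by move=> f; rewrite inE => /negbTE ->.
- by rewrite big_seq1 eqxx.
Qed.

Lemma gsum_homog (U : zmodType) (F : int -> V -> U) e v :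
  (forall d, F d 0 = 0) -> homog e v ->
  \sum_(d <- gsupp v) F d (gcomp d v) = F e v.
Proof.
move=> F0 hv; have [ev|ev] := boolP (e \in gsupp v).
  rewrite (bigD1_seq e) ?gsupp_uniq //= (gcomp_of_homog e hv) eqxx.
  rewrite big1 ?addr0 // => d /negbTE dNe.
  by rewrite (gcomp_of_homog d hv) dNe F0.
have v0 : v = 0 by have := gcomp_supp ev; rewrite (gcomp_of_homog e hv) eqxx.
rewrite big1 => [|d _]; first by rewrite v0 F0.
by rewrite (gcomp_of_homog d hv) v0 if_same F0.
Qed.

Lemma gsum_supp (U : zmodType) (F : int -> V -> U) v (t : seq int) :
  (forall d, F d 0 = 0) -> uniq t -> {subset gsupp v <= t} ->
  \sum_(d <- gsupp v) F d (gcomp d v) = \sum_(d <- t) F d (gcomp d v).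
Proof.
move=> F0 ut st; apply: big_undup_supp => //; first exact: gsupp_uniq.
by move=> d /gcomp_supp ->.
Qed.

(* [gsign m] is the linear extension of v |-> (-1)^(m |v|) v, see
   [gsign_homog]. *)
Definition gsign (m : int) v : V :=
  \sum_(d <- gsupp v) (-1) ^ (m * d) *: gcomp d v.

Lemma gsign_homog m d v : homog d v -> gsign m v = (-1) ^ (m * d) *: v.
Proof.
move=> hv; apply: (@gsum_homog _ (fun d x => (-1) ^ (m * d) *: x)) => //.
by move=> e; rewrite scaler0.
Qed.

Lemma gsign_is_linear m (a : K) u v :
  gsign m (a *: u + v) = a *: gsign m u + gsign m v.
Proof.
set t := undup (gsupp (a *: u + v) ++ (gsupp u ++ gsupp v)).
pose F d (x : V) := (-1 : K) ^ (m * d) *: x.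
have F0 d : F d 0 = 0 by rewrite /F scaler0.
have tE w : {subset gsupp w <= t} -> gsign m w = \sum_(d <- t) F d (gcomp d w).
  by move=> wt; apply: (@gsum_supp _ F) => //; apply: undup_uniq.
rewrite !tE.
- rewrite scaler_sumr -big_split; apply: eq_bigr => d _.
  by rewrite /F gcomp_is_linear scalerDr !scalerA mulrC.
- by move=> d h; rewrite mem_undup !mem_cat h !orbT.
- by move=> d h; rewrite mem_undup !mem_cat h !orbT.
- by move=> d h; rewrite mem_undup !mem_cat h.
Qed.

(* The entries of the list s are homogeneous, of degrees ds. *)
Fixpoint homogs (ds : seq int) s : Prop :=
  match ds, s with
  | [::], [::] => True
  | d :: ds', v :: s' => homog d v /\ homogs ds' s'
  | _, _ => False
  end.

Lemma homogs_size ds s : homogs ds s -> size ds = size s.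
Proof. by elim: ds s => [|d ds IH] [|v s] //= [_ /IH ->]. Qed.

Lemma homogs_nth ds s : homogs ds s <->
  size ds = size s /\ forall i, (i < size s)%N -> homog ds`_i s`_i.
Proof.
elim: ds s => [|d ds IH] [|v s] /=; split=> //; try by case.
  by case=> hv /IH [-> h]; split=> // -[|i] //=; apply: h.
case=> [[sz] h]; split; first exact: (h 0).
by apply/IH; split=> // i; apply: (h i.+1).
Qed.

Lemma homogs_cat ds es s t :
  homogs ds s -> homogs es t -> homogs (ds ++ es) (s ++ t).
Proof. by elim: ds s => [|d ds IH] [|v s] //= [hv /IH h] /h. Qed.

Lemma homogs_take n ds s : homogs ds s -> homogs (take n ds) (take n s).
Proof.
by elim: ds s n => [|d ds IH] [|v s] [|n] //= [hv /IH h]; split.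
Qed.

Lemma homogs_drop n ds s : homogs ds s -> homogs (drop n ds) (drop n s).
Proof. by elim: ds s n => [|d ds IH] [|v s] [|n] //= [hv /IH h]. Qed.

End GradedTheory.

Section DirectSum.
Variables (K : fieldType) (V W : gradedLmodType K).

Definition pair_homog (d : int) (p : V * W) : Prop := homog d p.1 /\ homog d p.2.

Lemma pair_homog0 d : pair_homog d 0.
Proof. by split; apply: homog0. Qed.

Lemma pair_homogP d (a : K) p q :
  pair_homog d p -> pair_homog d q -> pair_homog d (a *: p + q).
Proof. by move=> [? ?] [? ?]; split; apply: homogP. Qed.

Lemma fst_sum (I : Type) (r : seq I) (F : I -> V * W) :
  (\sum_(i <- r) F i).1 = \sum_(i <- r) (F i).1.
Proof. by elim/big_rec2: _ => [//|i x y _ <-]. Qed.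

Lemma snd_sum (I : Type) (r : seq I) (F : I -> V * W) :
  (\sum_(i <- r) F i).2 = \sum_(i <- r) (F i).2.
Proof. by elim/big_rec2: _ => [//|i x y _ <-]. Qed.

Lemma pair_homog_span (p : V * W) : exists s : seq (int * (V * W)),
  (forall q, q \in s -> pair_homog q.1 q.2) /\ p = \sum_(q <- s) q.2.
Proof.
have [s [hs sE]] := homog_span p.1; have [t [ht tE]] := homog_span p.2.
exists ([seq (q.1, (q.2, 0)) | q <- s] ++ [seq (q.1, (0, q.2)) | q <- t]); split.
  move=> q; rewrite mem_cat => /orP[] /mapP [r rs ->] /=.
    by split; [apply: hs | apply: homog0].
  by split; [apply: homog0 | apply: ht].
rewrite big_cat !big_map /= [p]surjective_pairing sE tE.
congr pair; rewrite /= ?fst_sum ?snd_sum /=.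
  by rewrite [X in _ + X]big1 ?addr0.
by rewrite [X in X + _]big1 ?add0r.
Qed.

Lemma pair_homog_indep (s : seq int) (c : int -> V * W) : uniq s ->
  (forall d, pair_homog d (c d)) -> \sum_(d <- s) c d = 0 ->
  forall d, d \in s -> c d = 0.
Proof.
move=> us hc c0 d ds; rewrite [c d]surjective_pairing.
have -> : (c d).1 = 0.
  apply: (@homog_indep K V s (fun d => (c d).1)) => //; first by move=> e; case: (hc e).
  by rewrite -fst_sum c0.
have -> // : (c d).2 = 0.
apply: (@homog_indep K W s (fun d => (c d).2)) => //; first by move=> e; case: (hc e).
by rewrite -snd_sum c0.
Qed.

HB.instance Definition _ := isGraded.Build K (V * W)%type
  pair_homog0 pair_homogP pair_homog_span pair_homog_indep.

End DirectSum.

(** * The graded vector space (+)_n C^n(V, W) *)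

Section MultilinearMaps.
Variables (K : fieldType) (V W : gradedLmodType K).
Implicit Types (f g : seq V -> W).

(* A linear map f from (+)_(k >= 1) V^{(x) k} to W, i.e. a formal sum of
   k-linear maps f_k for k >= 1, is a function on lists: the restriction of f
   to the lists of size k is f_k.  There is no component f_0, and f [::] is
   set to 0. *)
Definition multilinear f : Prop :=
  f [::] = 0 /\
  forall (s t : seq V) (a : K) u v,
    f (s ++ (a *: u + v) :: t) = a *: f (s ++ u :: t) + f (s ++ v :: t).

(* f \in C^n(V, W) *)
Definition inC (n : int) f : Prop :=
  multilinear f /\
  forall ds s, homogs ds s -> homog (n + \sum_(d <- ds) d) (f s).

Definition sumC : {pred seq V -> W} :=
  fun f => `[< exists r : seq (int * (seq V -> W)),
    (forall p, p \in r -> inC p.1 p.2) /\ f = \sum_(p <- r) p.2 >].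

Lemma multilinear0 : multilinear 0.
Proof. by split=> [//|s t a u v]; rewrite scaler0 addr0. Qed.

Lemma multilinearZD (a : K) f g :
  multilinear f -> multilinear g -> multilinear (a *: f + g).
Proof.
move=> [f0 fl] [g0 gl]; split=> [|s t b u v].
  by rewrite addrfctE /= scalrfctE /= f0 g0 scaler0 addr0.
rewrite !addrfctE /= !scalrfctE /= fl gl.
by rewrite !scalerDr !scalerA mulrC addrACA.
Qed.

Lemma inC0 n : inC n 0.
Proof. by split; [exact: multilinear0 | move=> ds s _; apply: homog0]. Qed.

Lemma inCP n (a : K) f g : inC n f -> inC n g -> inC n (a *: f + g).
Proof.
move=> [fm fd] [gm gd]; split; first exact: multilinearZD.
by move=> ds s h; rewrite addrfctE scalrfctE; apply: homogP; auto.
Qed.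

Lemma inC_sum n (I : eqType) (r : seq I) (P : pred I) (F : I -> seq V -> W) :
  (forall i, i \in r -> P i -> inC n (F i)) -> inC n (\sum_(i <- r | P i) F i).
Proof.
move=> h; rewrite big_seq_cond; elim/big_ind: _ => [|x y hx hy|i /andP[]].
- exact: inC0.
- by rewrite -[x]scale1r; apply: inCP.
- exact: h.
Qed.

Lemma sumC_inC n f : inC n f -> f \in sumC.
Proof.
move=> hf; apply/asboolP; exists [:: (n, f)]; rewrite big_seq1; split=> // p.
by rewrite inE => /eqP ->.
Qed.

Lemma sumC_submod_closed : submod_closed sumC.
Proof.
split; first exact: (sumC_inC (inC0 0)).
move=> a f g /asboolP[r [hr ->]] /asboolP[t [ht ->]]; apply/asboolP.
exists ([seq (p.1, a *: p.2) | p <- r] ++ t); split.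
  move=> p; rewrite mem_cat => /orP[/mapP[q qr ->]|/ht //] /=.
  by rewrite -[_ *: _]addr0; apply: inCP; [exact: hr | exact: inC0].
by rewrite big_cat big_map /= scaler_sumr.
Qed.

HB.instance Definition _ :=
  GRing.isSubmodClosed.Build K (seq V -> W) sumC sumC_submod_closed.

(* The elements of (+)_n C^n(V, W). *)
Record cochain := Cochain { cochain_fun :> seq V -> W; _ : cochain_fun \in sumC }.

HB.instance Definition _ := [isSub for cochain_fun].
HB.instance Definition _ := [Choice of cochain by <:].
HB.instance Definition _ := [SubChoice_isSubLmodule of cochain by <:].

Lemma cochain_sumE (I : Type) (r : seq I) (F : I -> cochain) s :
  (\sum_(i <- r) F i) s = \sum_(i <- r) F i s.
Proof.
elim: r => [|i r IH]; first by rewrite !big_nil.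
by rewrite !big_cons -IH.
Qed.

Definition cochain_homog (n : int) (f : cochain) : Prop := inC n f.

Lemma cochain_homog0 n : cochain_homog n 0.
Proof. exact: inC0. Qed.

Lemma cochain_homogP n (a : K) (f g : cochain) :
  cochain_homog n f -> cochain_homog n g -> cochain_homog n (a *: f + g).
Proof. exact: inCP. Qed.

Lemma cochain_homog_span (f : cochain) : exists r : seq (int * cochain),
  (forall p, p \in r -> cochain_homog p.1 p.2) /\ f = \sum_(p <- r) p.2.
Proof.
case: f => f fC; have /asboolP [r [hr fE]] := fC.
pose c (p : int * (seq V -> W)) := (p.1, insubd (0 : cochain) p.2).
exists (map c r); split.
  move=> p /mapP[q qr ->] /=; rewrite /cochain_homog.
  by have /hr hq := qr; rewrite -[cochain_fun _]/(val _) insubdK //; apply: (sumC_inC hq).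
apply: val_inj => /=; apply/funext => x; rewrite cochain_sumE big_map.
rewrite fE fct_sumE !big_seq; apply: eq_bigr => q qr /=.
by rewrite -[cochain_fun _]/(val _) insubdK //; apply: (sumC_inC (hr _ qr)).
Qed.

Lemma multilinear_sum f (s t : seq V) (I : Type) (r : seq I) (F : I -> V) :
  multilinear f ->
  f (s ++ (\sum_(i <- r) F i) :: t) = \sum_(i <- r) f (s ++ F i :: t).
Proof.
move=> [_ fl]; elim: r => [|i r IH].
  rewrite !big_nil; have := fl s t (-1) 0 0.
  by rewrite scaler0 addr0 scaleN1r addNr.
by rewrite !big_cons -[F i]scale1r fl IH !scale1r.
Qed.

Lemma multilinear_homog_eq0 f : multilinear f ->
  (forall ds s, homogs ds s -> f s = 0) -> f = 0.
Proof.
move=> fm f0; apply/funext => s; change (f s = 0).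
suff H : forall t s ds, homogs ds s -> f (s ++ t) = 0 by apply: (H s [::] [::]).
elim=> {s} [|v t IH] s ds hs; first by rewrite cats0; apply: f0 hs.
have [r [hr ->]] := homog_span v.
rewrite multilinear_sum // big_seq big1 // => p pr.
rewrite -cat_rcons -cats1; apply: (IH _ (ds ++ [:: p.1])).
by apply: homogs_cat => //=; split=> //; apply: hr.
Qed.

Lemma cochain_homog_indep (s : seq int) (c : int -> cochain) : uniq s ->
  (forall n, cochain_homog n (c n)) -> \sum_(n <- s) c n = 0 ->
  forall n, n \in s -> c n = 0.
Proof.
move=> us hc c0 n ns; apply: val_inj => /=.
apply: multilinear_homog_eq0 => [|ds x hx]; first by case: (hc n).
pose D := \sum_(d <- ds) d.
have := @homog_indep K W [seq m + D | m <- s] (fun e => c (e - D) x).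
move=> /(_ _ _ _ (n + D)); rewrite addrK; apply.
- by rewrite map_inj_uniq //; apply: addIr.
- by move=> d; have [_ /(_ _ _ hx)] := hc (d - D); rewrite -/D subrK.
- rewrite big_map; under eq_bigr do rewrite addrK.
  by rewrite -cochain_sumE c0.
- exact: map_f.
Qed.

HB.instance Definition _ := isGraded.Build K cochain
  cochain_homog0 cochain_homogP cochain_homog_span cochain_homog_indep.

Lemma cochain_multilinear (f : cochain) : multilinear f.
Proof.
case: f => f /= /asboolP[r [hr ->]]; rewrite big_seq.
elim/big_ind: _ => [|x y hx hy|p /hr []//]; first exact: multilinear0.
by rewrite -[x]scale1r; apply: multilinearZD.
Qed.

(* Multilinearity of f, with lists compared entrywise. *)
Lemma multilinear_nth f :
  f [::] = 0 ->
  (forall (j : nat) (a : K) (s t r : seq V),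
     (j < size s)%N -> size t = size s -> size r = size s ->
     (forall i, i != j -> s`_i = t`_i /\ s`_i = r`_i) ->
     s`_j = a *: t`_j + r`_j -> f s = a *: f t + f r) ->
  multilinear f.
Proof.
move=> f0 fl; split=> // s t a u v; apply: (fl (size s)).
- by rewrite size_cat /= addnS ltnS leq_addr.
- by rewrite !size_cat.
- by rewrite !size_cat.
- move=> i iN; rewrite !nth_cat; case: ltnP => // si.
  by rewrite -[(i - size s)%N]prednK // subn_gt0 ltn_neqAle eq_sym iN.
- by rewrite !nth_cat ltnn subnn.
Qed.

Lemma multilinear_nthE f (j : nat) (a : K) (s t r : seq V) :
  multilinear f ->
  (j < size s)%N -> size t = size s -> size r = size s ->
  (forall i, i != j -> s`_i = t`_i /\ s`_i = r`_i) ->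
  s`_j = a *: t`_j + r`_j -> f s = a *: f t + f r.
Proof.
move=> [_ fl] js ts rs h hj.
have sE (q : seq V) : size q = size s -> q = take j q ++ q`_j :: drop j.+1 q.
  by move=> qs; rewrite -drop_nth ?qs // cat_take_drop.
have tkE (q : seq V) : size q = size s -> (forall i, i != j -> s`_i = q`_i) ->
    take j q = take j s /\ drop j.+1 q = drop j.+1 s.
  move=> qs hq; split; apply: (@eq_from_nth _ 0).
  - by rewrite !size_take qs.
  - move=> i; rewrite size_take qs js => ij; rewrite !nth_take // hq //.
    by rewrite neq_ltn ij.
  - by rewrite !size_drop qs.
  - move=> i _; rewrite !nth_drop hq // neq_ltn.
    by apply/orP; right; rewrite addSn ltnS leq_addr.
have [t1 t2] := tkE t ts (fun i hi => (h i hi).1).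
have [r1 r2] := tkE r rs (fun i hi => (h i hi).2).
by rewrite (sE s) // (sE t) // (sE r) // t1 t2 r1 r2 hj fl.
Qed.

Lemma multilinear_zero f (s t : seq V) : multilinear f -> f (s ++ 0 :: t) = 0.
Proof.
move=> [_ fl]; have := fl s t (-1) 0 0.
by rewrite scaler0 addr0 scaleN1r addNr.
Qed.

Lemma inC_nth n f : f [::] = 0 ->
  (forall (j : nat) (a : K) (s t r : seq V),
     (j < size s)%N -> size t = size s -> size r = size s ->
     (forall i, i != j -> s`_i = t`_i /\ s`_i = r`_i) ->
     s`_j = a *: t`_j + r`_j -> f s = a *: f t + f r) ->
  (forall ds s, homogs ds s -> homog (n + \sum_(d <- ds) d) (f s)) -> inC n f.
Proof. by move=> *; split=> //; apply: multilinear_nth. Qed.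

End MultilinearMaps.

Lemma sumC_map (K : fieldType) (V W V' W' : gradedLmodType K)
    (phi : (seq V -> W) -> (seq V' -> W')) :
  (forall n f, inC n f -> inC n (phi f)) ->
  phi 0 = 0 -> (forall f g, phi (f + g) = phi f + phi g) ->
  forall f, f \in @sumC K V W -> phi f \in @sumC K V' W'.
Proof.
move=> hphi phi0 phiD f /asboolP[r [hr ->]].
have -> : phi (\sum_(p <- r) p.2) = \sum_(p <- r) phi p.2.
  by elim: {hr} r => [|p r IH]; rewrite ?big_nil // !big_cons phiD IH.
rewrite big_seq; apply: rpred_sum => p pr.
exact: (sumC_inC (hphi _ _ (hr _ pr))).
Qed.

(** * The graded Lie bracket *)

Section Bracket.
Variables (K : fieldType) (V : gradedLmodType K).
Local Notation G := (cochain V V).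

(* The sum over k + l = p + 1 of mu_k <> nu_l, for nu of degree m; p is the
   size of the list, i + 1 is the position where nu_l is inserted, and k is
   determined by the size of the list to which mu is applied.  The sign
   (-1)^(m (|a_1| + ... + |a_i|)) is distributed over a_1, ..., a_i, so that
   the formula makes sense for inhomogeneous entries; see [diamondE]. *)
Definition diamond_deg (m : int) (mu nu : seq V -> V) (s : seq V) : V :=
  \sum_(1 <= l < (size s).+1) \sum_(0 <= i < (size s - l).+1)
    mu ([seq gsign m a | a <- take i s]
          ++ nu (take l (drop i s)) :: drop (i + l) s).

Lemma take_catl n (s t : seq V) : (n <= size s)%N -> take n (s ++ t) = take n s.
Proof. exact: takel_cat. Qed.

Lemma drop_catl n (s t : seq V) :
  (n <= size s)%N -> drop n (s ++ t) = drop n s ++ t.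
Proof.
rewrite drop_cat leq_eqVlt => /orP[/eqP->|-> //].
by rewrite ltnn subnn drop0 drop_size.
Qed.

Lemma take_catr n (s t : seq V) v : (size s < n)%N ->
  take n (s ++ v :: t) = s ++ v :: take (n - size s).-1 t.
Proof.
by move=> sn; rewrite take_cat ltnNge (ltnW sn) /= -[in LHS](@prednK (n - size s)) ?subn_gt0.
Qed.

Lemma drop_catr n (s t : seq V) v : (size s < n)%N ->
  drop n (s ++ v :: t) = drop (n - size s).-1 t.
Proof.
by move=> sn; rewrite drop_cat ltnNge (ltnW sn) /= -[in LHS](@prednK (n - size s)) ?subn_gt0.
Qed.

Lemma diamond_deg_multilinear m (mu nu : seq V -> V) :
  multilinear mu -> multilinear nu -> multilinear (diamond_deg m mu nu).
Proof.
move=> [mu0 mul] [nu0 nul]; split; first by rewrite /diamond_deg big_geq.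
move=> s t a u v; rewrite /diamond_deg !size_cat /= scaler_sumr -big_split /=.
rewrite big_seq [RHS]big_seq; apply: eq_bigr => l _.
rewrite scaler_sumr -big_split /=; apply: eq_bigr => i _.
have [si|si] := ltnP (size s) i.
  rewrite !take_catr // !drop_catr ?(ltn_addr _ si) // !map_cat /= -!catA /=.
  by rewrite gsign_is_linear mul.
rewrite !(@drop_catl i) // !(@take_catl i) //.
have [sl|sl] := leqP (i + l) (size s).
  have ls : (l <= size (drop i s))%N by rewrite size_drop; lia.
  rewrite !(@drop_catl (i + l)) // !(@take_catl l) //.
  by rewrite -!(@cat_rcons _ (nu (take l (drop i s)))) !catA mul.
have ls : (size (drop i s) < l)%N by rewrite size_drop; lia.
by rewrite !take_catr // !drop_catr // nul mul.
Qed.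

Lemma gsign_homogs m ds s (mu : seq V -> V) t :
  multilinear mu -> homogs ds s ->
  mu ([seq gsign m a | a <- s] ++ t) =
    (-1) ^ (m * \sum_(d <- ds) d) *: mu (s ++ t).
Proof.
move=> [mu0 mul].
have mulZ s1 s2 (a : K) x : mu (s1 ++ a *: x :: s2) = a *: mu (s1 ++ x :: s2).
  by rewrite -[a *: x]addr0 mul multilinear_zero // addr0.
suff H : forall r, homogs ds s ->
    mu (r ++ [seq gsign m a | a <- s] ++ t) =
      (-1) ^ (m * \sum_(d <- ds) d) *: mu (r ++ s ++ t) by apply: (H [::]).
elim: s ds => [|v s IH] [|d ds] r //=; first by rewrite big_nil mulr0 scale1r.
case=> hv hs; rewrite (gsign_homog m hv) mulZ -cat_rcons (IH ds) // cat_rcons.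
by rewrite scalerA big_cons mulrDr expfzDr // oppr_eq0 oner_eq0.
Qed.

Lemma diamond_deg_inC n m (mu nu : seq V -> V) :
  inC n mu -> inC m nu -> inC (n + m) (diamond_deg m mu nu).
Proof.
move=> [mum muh] [num nuh]; split; first exact: diamond_deg_multilinear.
move=> ds s hs; apply: homog_sum => l; rewrite mem_index_iota => lp _.
apply: homog_sum => i _ _.
rewrite (@gsign_homogs _ (take i ds)) //; last exact: homogs_take.
apply: homogZ.
have h1 := homogs_take i hs; have h2 := homogs_drop i hs.
have h3 := homogs_take l h2; have h4 := homogs_drop l h2.
have h5 : homogs (take i ds ++ (m + \sum_(d <- take l (drop i ds)) d)
                    :: drop l (drop i ds))
    (take i s ++ nu (take l (drop i s)) :: drop (i + l) s).
  by apply: homogs_cat => //=; split; [exact: nuh | rewrite addnC -drop_drop].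
have := muh _ _ h5; congr (homog _ _).
rewrite -[in RHS](cat_take_drop i ds) -[in RHS](cat_take_drop l (drop i ds)).
by rewrite !big_cat big_cons /=; ring.
Qed.

Lemma diamond_deg_suml m (I : Type) (r : seq I) (F : I -> seq V -> V) nu :
  diamond_deg m (\sum_(i <- r) F i) nu = \sum_(i <- r) diamond_deg m (F i) nu.
Proof.
apply/funext => s; rewrite [in RHS]fct_sumE /diamond_deg [RHS]exchange_big.
apply: eq_bigr => l _; rewrite [RHS]exchange_big; apply: eq_bigr => i _.
by rewrite fct_sumE.
Qed.

Lemma cochainE (f : G) : f = \sum_(n <- gsupp f) (gcomp n f : seq V -> V) :> (seq V -> V).
Proof. by rewrite -[in LHS](gcomp_sum f); apply/funext => s; rewrite cochain_sumE fct_sumE. Qed.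

Definition diamond_fun (mu nu : G) : seq V -> V :=
  \sum_(m <- gsupp nu) diamond_deg m mu (gcomp m nu).

Lemma diamond_sumC mu nu : diamond_fun mu nu \in @sumC K V V.
Proof.
apply: rpred_sum => m _; rewrite (cochainE mu) diamond_deg_suml.
apply: rpred_sum => n _; apply: sumC_inC (n + m) _ _.
by apply: diamond_deg_inC; [exact: (gcomp_homog n mu) | exact: (gcomp_homog m nu)].
Qed.

(* mu <> nu, extended linearly to all nu in G. *)
Definition diamond (mu nu : G) : G := Cochain (diamond_sumC mu nu).

(* The degrees of mu and nu enter the bracket through a sign: it is extended
   bilinearly from the homogeneous elements. *)
Definition bracket (mu nu : G) : G :=
  \sum_(n <- gsupp mu) \sum_(m <- gsupp nu)
    (diamond (gcomp n mu) (gcomp m nu)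
       - (-1) ^ (m * n) *: diamond (gcomp m nu) (gcomp n mu)).

Lemma diamondE (mu nu : G) (m : int) (ds : seq int) (s : seq V) :
  homog m nu -> homogs ds s ->
  diamond mu nu s =
  \sum_(1 <= l < (size s).+1) \sum_(0 <= i < (size s - l).+1)
    (-1) ^ (m * \sum_(d <- take i ds) d) *:
      mu (take i s ++ nu (take l (drop i s)) :: drop (i + l) s).
Proof.
move=> hnu hs; have mum := cochain_multilinear mu.
rewrite /= /diamond_fun.
rewrite (@gsum_homog _ _ _ (fun m (x : G) => diamond_deg m mu x) m) //.
  apply: eq_bigr => l _; apply: eq_bigr => i _.
  by rewrite (@gsign_homogs _ (take i ds)) //; apply: homogs_take.
move=> e; apply/funext => q; rewrite /diamond_deg big1 // => l _.
by rewrite big1 // => i _; apply: multilinear_zero.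
Qed.

Lemma diamond0r (mu : G) : diamond mu 0 = 0.
Proof.
apply: val_inj; apply: multilinear_homog_eq0.
  exact: (cochain_multilinear (diamond mu 0)).
move=> ds s hs; change (diamond mu 0 s = 0); rewrite (@diamondE _ _ 0 ds) //; last exact: homog0.
rewrite big1 // => l _; rewrite big1 // => i _.
by rewrite multilinear_zero ?scaler0 //; apply: cochain_multilinear.
Qed.

Lemma diamond0l (nu : G) : diamond 0 nu = 0.
Proof.
apply: val_inj; rewrite /= /diamond_fun big1 // => m _.
by apply/funext => s; rewrite /diamond_deg big1 // => l _; rewrite big1.
Qed.

Lemma bracketE (mu nu : G) (n m : int) : homog n mu -> homog m nu ->
  bracket mu nu = diamond mu nu - (-1) ^ (m * n) *: diamond nu mu.
Proof.
move=> hmu hnu; rewrite /bracket.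
pose F n m (x y : G) := diamond x y - (-1) ^ (m * n) *: diamond y x.
rewrite (@gsum_homog _ _ _ (fun n x => \sum_(m <- gsupp nu) F n m x (gcomp m nu)) n) //.
  rewrite (@gsum_homog _ _ _ (fun m y => F n m mu y) m) // => e.
  by rewrite /F diamond0r diamond0l scaler0 subr0.
move=> e; rewrite big1 // => f _.
by rewrite /F diamond0r diamond0l scaler0 subr0.
Qed.

End Bracket.

(** * A_infinity- and L_infinity-algebras (shifted conventions) *)

(* The maps mu_k : A^{(x) k} -> A, k >= 1, form one element of C^{-1}(A, A).
   In the sum, k = n + 1 - l, and i starts from 0. *)
Record Ainf (K : fieldType) (A : gradedLmodType K) := {
  Ainf_map :> cochain A A;
  Ainf_degree : homog (-1) Ainf_map;
  Ainf_relation : forall (ds : seq int) (a : seq A),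
    (0 < size a)%N -> homogs ds a ->
    \sum_(1 <= l < (size a).+1) \sum_(0 <= i < (size a - l).+1)
      (-1) ^ (\sum_(d <- take i ds) d) *:
        Ainf_map (take i a ++ Ainf_map (take l (drop i a)) :: drop (i + l) a)
    = 0
}.

(* x_1 ... x_n = koszul_sign d s x_(s 1) ... x_(s n) in the free graded
   commutative algebra, where x_i has degree d i. *)
Definition koszul_sign (K : fieldType) (n : nat) (d : 'I_n -> int) (s : 'S_n) : K :=
  \prod_(i < n) \prod_(j < n | (i < j)%N && (s j < s i)%N)
    (-1) ^ (d (s i) * d (s j)).

Definition is_shuffle (n i : nat) (s : 'S_n) : bool :=
  [forall a : 'I_n, forall b : 'I_n,
     (a < b)%N && ((b < i)%N || (i <= a)%N) ==> (s a < s b)%N].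

Definition perm_seq (T : Type) (n : nat) (x : 'I_n -> T) (s : 'S_n) : seq T :=
  [seq x (s a) | a <- enum 'I_n].

(* In the Jacobi relation, j = n + 1 - i. *)
Record Linf (K : fieldType) (L : gradedLmodType K) := {
  Linf_map :> cochain L L;
  Linf_degree : homog (-1) Linf_map;
  Linf_symmetric : forall (n : nat) (d : 'I_n -> int) (x : 'I_n -> L) (s : 'S_n),
    (forall a, homog (d a) (x a)) ->
    Linf_map [seq x a | a <- enum 'I_n]
      = koszul_sign K d s *: Linf_map (perm_seq x s);
  Linf_relation : forall (n : nat) (d : 'I_n -> int) (x : 'I_n -> L),
    (0 < n)%N -> (forall a, homog (d a) (x a)) ->
    \sum_(1 <= i < n.+1) \sum_(s : 'S_n | is_shuffle i s)
      koszul_sign K d s *: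
        Linf_map (Linf_map (take i (perm_seq x s)) :: drop i (perm_seq x s))
    = 0
}.

(** * The data G, H, P, pi *)

Section DerivedBracketData.
Variables (K : fieldType) (A : gradedLmodType K).

(* In A * A, the first factor is the copy \bar A of A; likewise the first A
   in H. *)
Local Notation V := (A * A)%type.
Local Notation G := (cochain V V).
Local Notation H := (cochain A A).

(* Extension of f : \bar A^{(x) k} -> A to V^{(x) k} -> V, and P: restriction
   of the inputs to \bar A and projection of the output onto A. *)
Definition incl_fun (f : seq A -> A) (s : seq V) : V := (0, f [seq p.1 | p <- s]).

Lemma homogs_fst ds (s : seq V) : homogs ds s -> homogs ds [seq p.1 | p <- s].
Proof. by elim: ds s => [|d ds IH] [|v s] //= [[hv _] /IH]. Qed.

Lemma incl_inC n f : inC n f -> inC n (incl_fun f).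
Proof.
move=> [[f0 fl] fh]; split; first split.
- by rewrite /incl_fun /= f0.
- move=> s t a u v; rewrite /incl_fun !map_cat /= fl.
  by apply/pair_equal_spec; rewrite /= scaler0 addr0.
- move=> ds s hs; split; first exact: homog0.
  by apply: fh; apply: homogs_fst.
Qed.

Lemma incl_sumC (f : H) : incl_fun f \in @sumC K V V.
Proof.
case: f => f; apply: sumC_map; first exact: incl_inC.
  by [].
by move=> g h; apply/funext => s; apply/pair_equal_spec; rewrite /= addr0.
Qed.

Definition inclH (f : H) : G := Cochain (incl_sumC f).

Definition proj_fun (f : seq V -> V) (s : seq A) : A := (f [seq (a, 0) | a <- s]).2.

Lemma proj_inC n f : inC n f -> inC n (proj_fun f).
Proof.
move=> [[f0 fl] fh]; split; first split.
- by rewrite /proj_fun /= f0.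
- move=> s t a u v; rewrite /proj_fun !map_cat /=.
  have -> : (a *: u + v, 0) = a *: ((u, 0) : V) + (v, 0).
    by apply/pair_equal_spec; rewrite /= scaler0 addr0.
  by rewrite fl.
- move=> ds s hs; suff h : homogs ds [seq ((a, 0) : V) | a <- s] by case: (fh _ _ h).
  elim: ds s hs => [|d ds IH] [|v s] //= [hv /IH h]; split=> //; split=> //.
  exact: homog0.
Qed.

Lemma proj_sumC (f : G) : proj_fun f \in @sumC K A A.
Proof. by case: f => f; apply: sumC_map; first exact: proj_inC. Qed.

Definition projH (f : G) : H := Cochain (proj_sumC f).

Variable mu : Ainf A.

(* The entries a_i of s = [:: (a_1, x_1); ...; (a_k, x_k)] with i in I are
   replaced with x_i. *)
Definition replaced (k : nat) (I : {set 'I_k}) (s : seq V) : seq A :=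
  [seq if i \in I then (s`_i).2 else (s`_i).1 | i : 'I_k <- enum 'I_k].

Definition pi_snd (k : nat) (s : seq V) : A :=
  \sum_(1 <= p < k.+1) \sum_(I : {set 'I_k} | #|I| == p) mu (replaced I s).

(* (a_1, x_1), ..., (a_k, x_k) |->
   (mu_k(a_1, ..., a_k), sum over nonempty I of mu_k(replaced I)) *)
Definition pi_fun (s : seq V) : V := (mu [seq p.1 | p <- s], pi_snd (size s) s).

Lemma size_replace k (I : {set 'I_k}) s : size (replaced I s) = k.
Proof. by rewrite size_map size_enum_ord. Qed.

Lemma nth_replace k (I : {set 'I_k}) s (i : 'I_k) :
  (replaced I s)`_i = if i \in I then (s`_i).2 else (s`_i).1.
Proof. by rewrite (nth_map i) ?size_enum_ord // nth_ord_enum. Qed.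

Lemma pi_inC : inC (-1) pi_fun.
Proof.
have [[mu0 mul] muh] : inC (-1) mu := Ainf_degree mu.
apply: inC_nth.
- by rewrite /pi_fun /= mu0 /pi_snd big_geq.
- move=> j a s t r js ts rs h hj; rewrite /pi_fun ts rs.
  have mum : multilinear mu by [].
  apply/pair_equal_spec; split=> /=.
    apply: (multilinear_nthE (j := j) mum); rewrite ?size_map ?ts ?rs //.
      move=> i ij; have [is_|is_] := ltnP i (size s); last first.
        by rewrite !nth_default ?size_map ?ts ?rs.
      by have [ht hr] := h i ij; rewrite !(nth_map 0) ?ts ?rs // -ht -hr.
    by rewrite !(nth_map 0) ?ts ?rs // hj.
  rewrite /pi_snd scaler_sumr -big_split; apply: eq_bigr => p _ /=.
  rewrite scaler_sumr -big_split; apply: eq_bigr => I _ /=.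
  apply: (multilinear_nthE (j := j) mum); rewrite ?size_replace //.
    move=> i ij; have [is_|is_] := ltnP i (size s); last first.
      by rewrite !nth_default ?size_replace.
    have [ht hr] := h i ij.
    by rewrite -[i]/(val (Ordinal is_)) !nth_replace /= -ht -hr.
  by rewrite -[j]/(val (Ordinal js)) !nth_replace /= hj; case: ifP.
- move=> ds s hs; split; first by apply: muh; apply: homogs_fst.
  apply: homog_sum => p _ _; apply: homog_sum => I _ _; apply: muh.
  have /homogs_nth[sz hn] := hs; apply/homogs_nth; rewrite size_replace; split=> //.
  move=> i is_; rewrite -[i]/(val (Ordinal is_)) nth_replace /=.
  by case: (hn i is_) => ? ?; case: ifP.
Qed.

Definition pi_Ainf : G := Cochain (sumC_inC pi_inC).

End DerivedBracketData.

(* Main.v *)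
Require Import Defs.
From HB Require Import structures.
From mathcomp Require Import all_boot all_order all_fingroup all_algebra.
From mathcomp Require Import boolp classical_sets functions.
From mathcomp Require Import ring.

Set Implicit Arguments.
Unset Strict Implicit.
Unset Printing Implicit Defensive.

Import GRing.Theory.
Local Open Scope ring_scope.

(** Two facts make the structure maps satisfy the L-infinity relations.

    Voronov's higher derived brackets.  Let G be a graded Lie algebra, H an
    abelian subalgebra, P : G -> H a projection whose kernel is a subalgebra,
    and pi in ker P of degree -1 with [pi, pi] = 0.  Write D(xs) for
    [..[[pi, x1], x2].., xn].  As H is abelian, the Jacobi identity lets two
    consecutive arguments of D be exchanged up to the Koszul sign, whence the
    symmetry of P D ([derived_symmetric]).  Bracketing with an element is a
    derivation, so 0 = [..[[pi, pi], x1].., xn] is a signed sum of the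
    [D(x_I), D(x_J)] over all the ways of dividing the arguments into two
    complementary families ([foldl_br_derivation]).  Applying P and
    P[u, v] = P[P u, v] + P[u, P v] ([P_bracket]), the two halves of the
    result agree after exchanging I and J, and each of them is the sum of the
    P D(P D(x_I), x_J).  Dividing by 2 gives the generalized Jacobi relation
    ([derived_jacobi]).  The sum over I is a sum over shuffles because a
    shuffle amounts to the set of its first values ([sum_shuffles]).

    The data satisfy Voronov's hypotheses.  The insertion product underlying
    the bracket is graded pre-Lie ([diamond_deg_prelie]), so its commutator is
    a graded Lie bracket.  The relation [pi, pi] = 0 comes from the change of
    coordinates (a, x) |-> (a, a + x): a sum over nonempty sets I of the
    replacements of a_i with x_i for i in I is
    mu(a_1 + x_1, ..., a_k + x_k) - mu(a_1, ..., a_k), so that both a and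
    a + x are strict morphisms from pi to mu ([pi_add]), and together they are
    injective ([pi_sq]). *)

(** * Signs *)

Section Signs.
Variables (K : fieldType).

Lemma signzD (m n : int) : (-1) ^ (m + n) = (-1) ^ m * (-1) ^ n :> K.
Proof. by rewrite expfzDr // oppr_eq0 oner_eq0. Qed.

Lemma signz_parity (k m n : int) : m = n + k * 2 -> (-1) ^ m = (-1) ^ n :> K.
Proof.
move=> ->; rewrite signzD (mulrC k) -exprz_exp.
by rewrite -[(-1) ^ 2]/((-1) ^+ 2) sqrrN expr1n exp1rz mulr1.
Qed.

Lemma signz_sq (m : int) : (-1) ^ m * (-1) ^ m = 1 :> K.
Proof. by rewrite -signzD (@signz_parity m _ 0) //; ring. Qed.

End Signs.

(** * The insertion product is graded pre-Lie *)

Section Insertion.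
Variables (K : fieldType) (V : gradedLmodType K).
Implicit Types (f x y z : seq V -> V) (s t : seq V) (u v w : V).

HB.instance Definition _ m :=
  GRing.isLinear.Build K V V *:%R (@gsign K V m) (gsign_is_linear m).

Lemma gsign_sum m (I : Type) (r : seq I) (F : I -> V) :
  gsign m (\sum_(i <- r) F i) = \sum_(i <- r) gsign m (F i).
Proof. exact: (linear_sum (gsign m : {linear V -> V})). Qed.

Lemma gsignD m n v : gsign m (gsign n v) = gsign (m + n) v.
Proof.
have [s [hs ->]] := homog_span v; rewrite (gsign_sum n) 2!gsign_sum big_seq [RHS]big_seq.
apply: eq_bigr => p /hs hp; rewrite !(gsign_homog _ hp) linearZ /= (gsign_homog _ hp).
by rewrite scalerA mulrDl signzD mulrC.
Qed.

(** The degree of the output differs by n from the total degree of the inputs.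
    This is the origin of the sign in the pre-Lie identity. *)
Lemma inC_gsign k n f s : inC n f ->
  f [seq gsign k v | v <- s] = (-1) ^ (n * k) *: gsign k (f s).
Proof.
move=> [fm fh]; apply/eqP; rewrite -subr_eq0; apply/eqP.
pose g s := f [seq gsign k v | v <- s] - (-1) ^ (n * k) *: gsign k (f s).
suff g0 : g = 0 by rewrite -[LHS]/(g s) g0.
apply: multilinear_homog_eq0.
  have [f0 fl] := fm; split; first by rewrite /g /= f0 linear0 scaler0 subr0.
  move=> t r a u v; rewrite /g !map_cat /= fl linearP /= fl linearP /=.
  rewrite !scalerDr !scalerN !scalerA [_ * a]mulrC -!addrA; congr (_ + _).
  by rewrite opprD addrCA.
move=> ds t ht; have := gsign_homogs k [::] fm ht; rewrite /g !cats0 => ->.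
rewrite (gsign_homog _ (fh _ _ ht)) scalerA -signzD; apply/eqP.
rewrite subr_eq0; apply/eqP; congr (_ *: _); apply: (@signz_parity _ (- (n * k))).
by ring.
Qed.

(** No condition is put on the empty list, so that the property passes from f
    to [plug f v]. *)
Definition slotlinear f : Prop := forall s t (a : K) u v,
  f (s ++ (a *: u + v) :: t) = a *: f (s ++ u :: t) + f (s ++ v :: t).

Definition plug f v : seq V -> V := fun s => f (v :: s).

Definition cut_sum (F : seq V -> seq V -> V) s : V :=
  \sum_(0 <= i < (size s).+1) F (take i s) (drop i s).

(** These are the terms of the insertion product where y takes an initial
    segment.  The segment may be empty: y will be some [plug y v], which has
    already received an argument. *)
Definition hit x y : seq V -> V := cut_sum (fun t r => x (y t :: r)).

Lemma slotlinear_plug f v : slotlinear f -> slotlinear (plug f v).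
Proof. by move=> fl s t a u w; apply: (fl (v :: s)). Qed.

Lemma slotlinear_headD f u v t : slotlinear f ->
  f ((u + v) :: t) = f (u :: t) + f (v :: t).
Proof. by move=> fl; have := fl [::] t 1 u v; rewrite !scale1r. Qed.

Lemma slotlinear_head0 f t : slotlinear f -> f (0 :: t) = 0.
Proof.
by move=> fl; have := fl [::] t (-1) 0 0; rewrite scaler0 addr0 scaleN1r addNr.
Qed.

Lemma slotlinear_headZ f a u t : slotlinear f -> f (a *: u :: t) = a *: f (u :: t).
Proof.
by move=> fl; have := fl [::] t a u 0; rewrite addr0 /= slotlinear_head0 // addr0.
Qed.

Lemma cut_sum_nil (F : seq V -> seq V -> V) : cut_sum F [::] = F [::] [::].
Proof. by rewrite /cut_sum big_nat1. Qed.

Lemma cut_sum_cons F v s :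
  cut_sum F (v :: s) = F [::] (v :: s) + cut_sum (fun t r => F (v :: t) r) s.
Proof. by rewrite /cut_sum big_nat_recl //= take0 drop0. Qed.

Lemma eq_cut_sum F1 F2 s : (forall t r, F1 t r = F2 t r) -> cut_sum F1 s = cut_sum F2 s.
Proof. by move=> h; apply: eq_bigr => i _; apply: h. Qed.

Lemma cut_sumD F1 F2 s :
  cut_sum (fun t r => F1 t r + F2 t r) s = cut_sum F1 s + cut_sum F2 s.
Proof. exact: big_split. Qed.

Lemma cut_sumZ (a : K) F s : cut_sum (fun t r => a *: F t r) s = a *: cut_sum F s.
Proof. by rewrite /cut_sum scaler_sumr. Qed.

Lemma hit_cons x y v s : hit x y (v :: s) = x (y [::] :: v :: s) + hit x (plug y v) s.
Proof. exact: cut_sum_cons. Qed.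

Lemma hitDr x y1 y2 s : slotlinear x ->
  hit x (fun t => y1 t + y2 t) s = hit x y1 s + hit x y2 s.
Proof.
by move=> xl; rewrite -cut_sumD; apply: eq_cut_sum => t r; apply: slotlinear_headD.
Qed.

Lemma diamond_deg_nil m x y : diamond_deg m x y [::] = 0.
Proof. by rewrite /diamond_deg big_geq. Qed.

(** Either the first argument goes to y, or it stays with x and the insertion
    takes place further on.  This recursion replaces all reasoning on positions
    in the proof of the pre-Lie identity. *)
Lemma diamond_deg_cons m x y v s :
  diamond_deg m x y (v :: s) =
  hit x (plug y v) s + diamond_deg m (plug x (gsign m v)) y s.
Proof.
rewrite /diamond_deg /hit /cut_sum /=.
under eq_bigr => l _ do rewrite big_nat_recl //=.
rewrite big_split /=; congr (_ + _).
  rewrite big_add1; apply: eq_bigr => i _.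
  by rewrite add0n.
rewrite big_nat_recr //= subSS subnn [X in _ + X]big_geq // addr0.
rewrite big_nat [RHS]big_nat; apply: eq_bigr => l /andP[l1 ls].
by rewrite subSn.
Qed.

Lemma diamond_degDl m x1 x2 y s :
  diamond_deg m (fun t => x1 t + x2 t) y s = diamond_deg m x1 y s + diamond_deg m x2 y s.
Proof.
rewrite /diamond_deg -big_split; apply: eq_bigr => l _.
by rewrite -big_split.
Qed.

Lemma diamond_degZl m (a : K) x y s :
  diamond_deg m (fun t => a *: x t) y s = a *: diamond_deg m x y s.
Proof.
rewrite /diamond_deg scaler_sumr; apply: eq_bigr => l _.
by rewrite scaler_sumr.
Qed.

Lemma hit_assoc x y z s : slotlinear x ->
  cut_sum (fun t r => hit x (plug y (z t)) r) s = hit x (hit y z) s.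
Proof.
move=> xl; elim: s z => [|v s IH] z.
  by rewrite cut_sum_nil /hit !cut_sum_nil.
rewrite cut_sum_cons (IH (plug z v)) !hit_cons -addrA; congr (_ + _).
  by rewrite /hit cut_sum_nil.
rewrite -hitDr //; apply: eq_cut_sum => t r; congr (x (_ :: r)).
by rewrite /plug hit_cons.
Qed.

(** In the terms on the left, z is inserted either among the arguments of y or
    to the right of them. *)
Lemma hit_diamond p x y z s : slotlinear x ->
  diamond_deg p (hit x y) z s =
  hit x (diamond_deg p y z) s +
  cut_sum (fun t r => diamond_deg p (plug x (y [seq gsign p u | u <- t])) z r) s.
Proof.
move=> xl; elim: s y => [|v s IH] y.
  rewrite /hit !cut_sum_nil !diamond_deg_nil slotlinear_head0 // addr0 //.
rewrite diamond_deg_cons cut_sum_cons hit_cons diamond_deg_nil slotlinear_head0 // add0r.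
have -> : hit x (plug (diamond_deg p y z) v) s =
    hit x (hit y (plug z v)) s + hit x (diamond_deg p (plug y (gsign p v)) z) s.
  by rewrite -hitDr //; apply: eq_cut_sum => t r; rewrite /plug diamond_deg_cons.
have -> : plug (hit x y) (gsign p v) = (fun t => plug (plug x (y [::])) (gsign p v) t
    + hit x (plug y (gsign p v)) t) by apply/funext => t; rewrite /plug hit_cons.
rewrite diamond_degDl IH.
have -> : hit (hit x y) (plug z v) s =
    hit (plug x (y [::])) (plug z v) s + hit x (hit y (plug z v)) s.
  rewrite -hit_assoc // -cut_sumD; apply: eq_cut_sum => t r.
  by rewrite hit_cons.
rewrite diamond_deg_cons /=; set a := hit _ _ _; set b := hit _ _ _.
set c := diamond_deg _ _ _ _; set d := hit _ _ _; set e := cut_sum _ _.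
by rewrite (AC (2*(1*2)) ((2*4)*((1*3)*5))).
Qed.

(** The terms with z inserted among the arguments of y cancel in the associator.
    In the others y and z are both arguments of x, and v goes to x, to z or
    to y. *)
Lemma diamond_deg_assocE m p x y z v s : slotlinear x ->
  diamond_deg p (diamond_deg m x y) z (v :: s)
    - diamond_deg (m + p) x (diamond_deg p y z) (v :: s) =
  diamond_deg p (diamond_deg m (plug x (gsign (m + p) v)) y) z s
    - diamond_deg (m + p) (plug x (gsign (m + p) v)) (diamond_deg p y z) s
  + (cut_sum (fun t r => diamond_deg m (plug x (gsign m (z (v :: t)))) y r) s
     + cut_sum (fun t r => diamond_deg p
                (plug x (y [seq gsign p u | u <- v :: t])) z r) s).
Proof.
move=> xl; rewrite !diamond_deg_cons.
have -> : hit (diamond_deg m x y) (plug z v) s =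
    hit x (hit y (plug z v)) s
      + cut_sum (fun t r => diamond_deg m (plug x (gsign m (z (v :: t)))) y r) s.
  rewrite -hit_assoc // -cut_sumD; apply: eq_cut_sum => t r.
  exact: diamond_deg_cons.
have -> : plug (diamond_deg m x y) (gsign p v) = (fun t =>
    hit x (plug y (gsign p v)) t + diamond_deg m (plug x (gsign (m + p) v)) y t).
  by apply/funext => t; rewrite /plug diamond_deg_cons gsignD.
have -> : hit x (plug (diamond_deg p y z) v) s =
    hit x (hit y (plug z v)) s + hit x (diamond_deg p (plug y (gsign p v)) z) s.
  by rewrite -hitDr //; apply: eq_cut_sum => t r; rewrite /plug diamond_deg_cons.
rewrite diamond_degDl hit_diamond //=.
set a := hit _ _ _; set b := cut_sum _ _; set c := hit _ _ _; set d := cut_sum _ _.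
set e := diamond_deg _ _ _ _; set f := diamond_deg _ _ _ _.
rewrite opprD [- (a + c)]opprD (AC ((2*(2*1))*((2*1))) (((1*6)*(3*7))*((5*8)*(2*4)))) /=.
by rewrite !subrr add0r add0r.
Qed.

(** The associator (x.y).z - x.(y.z) sums over the ways of inserting y and z at
    two disjoint segments of the arguments of x; hence its symmetry in y and
    z. *)
Lemma diamond_deg_prelie m p x y z s : slotlinear x -> inC m y -> inC p z ->
  diamond_deg p (diamond_deg m x y) z s - diamond_deg (m + p) x (diamond_deg p y z) s =
  (-1) ^ (m * p) *:
    (diamond_deg m (diamond_deg p x z) y s - diamond_deg (m + p) x (diamond_deg m z y) s).
Proof.
move=> xl yC zC; elim: s x xl => [|v s IH] x xl.
  by rewrite !diamond_deg_nil !subrr scaler0.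
rewrite diamond_deg_assocE // [m + p in RHS]addrC diamond_deg_assocE //.
rewrite [p + m]addrC IH; last exact: slotlinear_plug.
rewrite [RHS]scalerDr; congr (_ + _).
have H k l f g t : inC k f -> inC l g ->
    cut_sum (fun t r => diamond_deg l (plug x (f [seq gsign l u | u <- v :: t])) g r) t
    = (-1) ^ (k * l) *:
      cut_sum (fun t r => diamond_deg l (plug x (gsign l (f (v :: t)))) g r) t.
  move=> fC gC; rewrite -cut_sumZ; apply: eq_cut_sum => q r.
  rewrite -diamond_degZl (inC_gsign _ _ fC); congr (diamond_deg _ _ _ _).
  by apply/funext => w; rewrite /plug slotlinear_headZ.
rewrite (H m p y z) // (H p m z y) // scalerDr scalerA mulrC.
by rewrite [p * m]mulrC signz_sq scale1r addrC.
Qed.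

End Insertion.

(** * The graded Lie algebra of cochains *)

Record graded_lie_bracket (K : fieldType) (G : gradedLmodType K)
    (br : G -> G -> G) : Prop := GradedLieBracket {
  br_linearl : forall w (a : K) u v, br (a *: u + v) w = a *: br u w + br v w;
  br_linearr : forall w (a : K) u v, br w (a *: u + v) = a *: br w u + br w v;
  br_homog : forall n m u v, homog n u -> homog m v -> homog (n + m) (br u v);
  br_antisym : forall n m u v, homog n u -> homog m v ->
    br u v = - ((-1) ^ (n * m) *: br v u);
  br_jacobi : forall n m p u v w, homog n u -> homog m v -> homog p w ->
    br (br u v) w = br u (br v w) + (-1) ^ (m * p) *: br (br u w) v
}.

(** The linear extension of a family of operations defined degree by degree, as
    used for the insertion product and the bracket, is linear. *)
Lemma gsum_linear (K : fieldType) (V : gradedLmodType K) (U : lmodType K)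
    (F : int -> V -> U) :
  (forall d (a : K) u v, F d (a *: u + v) = a *: F d u + F d v) ->
  forall (a : K) u v,
    \sum_(d <- gsupp (a *: u + v)) F d (gcomp d (a *: u + v)) =
    a *: (\sum_(d <- gsupp u) F d (gcomp d u)) + \sum_(d <- gsupp v) F d (gcomp d v).
Proof.
move=> FD a u v; have F0 d : F d 0 = 0.
  by have := FD d (-1) 0 0; rewrite scaler0 addr0 scaleN1r addNr.
set t := undup (gsupp (a *: u + v) ++ (gsupp u ++ gsupp v)).
have tE w : {subset gsupp w <= t} ->
    \sum_(d <- gsupp w) F d (gcomp d w) = \sum_(d <- t) F d (gcomp d w).
  by move=> wt; apply: gsum_supp => //; apply: undup_uniq.
rewrite !tE.
- rewrite scaler_sumr -big_split; apply: eq_bigr => d _.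
  by rewrite gcomp_is_linear FD.
- by move=> d h; rewrite mem_undup !mem_cat h !orbT.
- by move=> d h; rewrite mem_undup !mem_cat h !orbT.
- by move=> d h; rewrite mem_undup !mem_cat h.
Qed.

(** The variables stand for the twelve triple products of x, y and z, and a, b,
    c for the signs of exchanging x and y, y and z, x and z.  The difference of
    the two sides is a combination of the three pre-Lie identities. *)
Lemma jacobi_of_prelie (K : fieldType) (M : lmodType K) (a b c : K)
    (xy_z x_yz xz_y x_zy yx_z y_xz yz_x y_zx zx_y z_xy zy_x z_yx : M) :
  a * a = 1 -> b * b = 1 -> c * c = 1 ->
  xy_z - x_yz = b *: (xz_y - x_zy) ->
  yx_z - y_xz = c *: (yz_x - y_zx) ->
  zx_y - z_xy = a *: (zy_x - z_yx) ->
  xy_z - a *: yx_z - (c * b) *: (z_xy - a *: z_yx) =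
  x_yz - b *: x_zy - (a * c) *: (yz_x - b *: zy_x)
  + b *: (xz_y - c *: zx_y - (a * b) *: (y_xz - c *: y_zx)).
Proof.
move=> aa bb cc P1 P2 P3; apply/eqP; rewrite -subr_eq0; apply/eqP.
transitivity ((xy_z - x_yz - b *: (xz_y - x_zy))
   - a *: (yx_z - y_xz - c *: (yz_x - y_zx))
   + (b * c) *: (zx_y - z_xy - a *: (zy_x - z_yx))); last first.
  by rewrite P1 P2 P3 !subrr !scaler0 subr0 addr0.
rewrite !(scalerDr, scalerN, opprD, opprK, scalerA).
have -> : b * (a * b) = a by rewrite mulrCA bb mulr1.
have -> : a * c * b = b * c * a by rewrite mulrC mulrA mulrAC.
rewrite [c * b]mulrC.
by rewrite [LHS](AC ((2*2)*((2*2)*(2*2))) (((1*5)*(9*6))*((2*11)*(7*12))*((10*3)*(8*4)))) /=.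
Qed.

Section CochainBracket.
Variables (K : fieldType) (V : gradedLmodType K).
Local Notation G := (cochain V V).
Implicit Types (mu nu x y z : G).

Lemma cochain_eqP x y : (x = y :> (seq V -> V)) -> x = y.
Proof. exact: val_inj. Qed.

Lemma cochain_slotlinear mu : slotlinear mu.
Proof. by case: (cochain_multilinear mu). Qed.

Lemma diamond_homE m mu nu : homog m nu ->
  diamond mu nu = diamond_deg m mu nu :> (seq V -> V).
Proof.
move=> hnu; rewrite /= /diamond_fun.
apply: (@gsum_homog _ _ _ (fun m (x : G) => diamond_deg m mu x) m) => // e.
apply/funext => q; rewrite /diamond_deg big1 // => l _.
by rewrite big1 // => i _; apply/multilinear_zero/cochain_multilinear.
Qed.

Lemma diamond_homog n m mu nu :
  homog n mu -> homog m nu -> homog (n + m) (diamond mu nu).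
Proof.
move=> hmu hnu; rewrite /homog /= /cochain_homog (diamond_homE _ hnu).
exact: diamond_deg_inC.
Qed.

Lemma diamond_linearl nu (a : K) x y :
  diamond (a *: x + y) nu = a *: diamond x nu + diamond y nu.
Proof.
apply: cochain_eqP; apply/funext => s.
rewrite /= /diamond_fun -[RHS]/(a *: diamond_fun x nu s + diamond_fun y nu s).
rewrite /diamond_fun !fct_sumE scaler_sumr -big_split; apply: eq_bigr => m _ /=.
rewrite /diamond_deg scaler_sumr -big_split; apply: eq_bigr => l _ /=.
by rewrite scaler_sumr -big_split.
Qed.

Lemma diamond_linearr mu (a : K) x y :
  diamond mu (a *: x + y) = a *: diamond mu x + diamond mu y.
Proof.
apply: cochain_eqP.
rewrite /= -[RHS]/(a *: diamond_fun mu x + diamond_fun mu y) /diamond_fun.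
apply: (@gsum_linear K G (seq V -> V) (fun m z => diamond_deg m mu z)) => {}m {}b {}x {}y.
apply/funext => s.
rewrite -[RHS]/(b *: diamond_deg m mu x s + diamond_deg m mu y s).
rewrite /diamond_deg scaler_sumr -big_split; apply: eq_bigr => l _ /=.
rewrite scaler_sumr -big_split; apply: eq_bigr => i _ /=.
exact: cochain_slotlinear.
Qed.

Lemma bracket_linearl nu (a : K) x y :
  bracket (a *: x + y) nu = a *: bracket x nu + bracket y nu.
Proof.
rewrite /bracket.
apply: (@gsum_linear K G G (fun n z => \sum_(m <- gsupp nu)
  (diamond z (gcomp m nu) - (-1) ^ (m * n) *: diamond (gcomp m nu) z))).
move=> n b u v; rewrite scaler_sumr -big_split; apply: eq_bigr => m _ /=.
rewrite diamond_linearl diamond_linearr !scalerDr !scalerN !scalerA opprD.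
by rewrite [b * _]mulrC addrACA.
Qed.

Lemma bracket_linearr nu (a : K) x y :
  bracket nu (a *: x + y) = a *: bracket nu x + bracket nu y.
Proof.
rewrite /bracket scaler_sumr -big_split; apply: eq_bigr => n _ /=.
apply: (@gsum_linear K G G (fun m z =>
  (diamond (gcomp n nu) z - (-1) ^ (m * n) *: diamond z (gcomp n nu)))).
move=> m b u v; rewrite diamond_linearl diamond_linearr.
by rewrite !scalerDr !scalerN !scalerA opprD [b * _]mulrC addrACA.
Qed.

Lemma diamond_prelie m p x y z : homog m y -> homog p z ->
  diamond (diamond x y) z - diamond x (diamond y z) =
  (-1) ^ (m * p) *: (diamond (diamond x z) y - diamond x (diamond z y)).
Proof.
move=> hy hz; have hyz := diamond_homog hy hz; have hzy := diamond_homog hz hy.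
rewrite addrC in hzy.
apply: cochain_eqP; apply/funext => s.
rewrite -[LHS]/(diamond (diamond x y) z s - diamond x (diamond y z) s).
rewrite -[RHS]/(_ *: (diamond (diamond x z) y s - diamond x (diamond z y) s)).
rewrite (diamond_homE _ hyz) (diamond_homE _ hzy).
rewrite !(diamond_homE _ hz) !(diamond_homE _ hy) (diamond_homE _ hz).
by apply: diamond_deg_prelie => //; apply: cochain_slotlinear.
Qed.

Lemma bracket_homog n m x y : homog n x -> homog m y -> homog (n + m) (bracket x y).
Proof.
move=> hx hy; rewrite (bracketE hx hy); apply: homogB; first exact: diamond_homog.
by apply: homogZ; rewrite addrC; apply: diamond_homog.
Qed.

Lemma bracket_antisym n m x y : homog n x -> homog m y ->
  bracket x y = - ((-1) ^ (n * m) *: bracket y x).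
Proof.
move=> hx hy; rewrite (bracketE hx hy) (bracketE hy hx) scalerBr scalerA.
by rewrite signz_sq scale1r opprB mulrC.
Qed.

Lemma bracket_jacobi n m p x y z : homog n x -> homog m y -> homog p z ->
  bracket (bracket x y) z =
  bracket x (bracket y z) + (-1) ^ (m * p) *: bracket (bracket x z) y.
Proof.
move=> hx hy hz.
have dBl (u v w : G) : diamond (u - v) w = diamond u w - diamond v w.
  by rewrite [u - v]addrC -[- v]scaleN1r (diamond_linearl w (-1) v u) scaleN1r addrC.
have dBr (u v w : G) : diamond w (u - v) = diamond w u - diamond w v.
  by rewrite [u - v]addrC -[- v]scaleN1r (diamond_linearr w (-1) v u) scaleN1r addrC.
have dZl a (u w : G) : diamond (a *: u) w = a *: diamond u w.
  by rewrite -[a *: u]addr0 diamond_linearl diamond0l addr0.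
have dZr a (u w : G) : diamond w (a *: u) = a *: diamond w u.
  by rewrite -[a *: u]addr0 diamond_linearr diamond0r addr0.
rewrite (bracketE (bracket_homog hx hy) hz) (bracketE (bracket_homog hx hz) hy).
rewrite (bracketE hx (bracket_homog hy hz)).
rewrite (bracketE hx hy) (bracketE hx hz) (bracketE hy hz).
rewrite !(dBl, dBr, dZl, dZr).
rewrite !mulrDr !mulrDl !signzD [p * m]mulrC [p * n]mulrC.
have := diamond_prelie z hx hy; have := diamond_prelie y hx hz.
have := diamond_prelie x hy hz; rewrite [m * n]mulrC.
apply: jacobi_of_prelie; exact: signz_sq.
Qed.

Lemma bracket_graded_lie : graded_lie_bracket (@bracket K V).
Proof.
split; [exact: bracket_linearl | exact: bracket_linearr | exact: bracket_homog
  | exact: bracket_antisym | exact: bracket_jacobi].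
Qed.

End CochainBracket.

(** * Iterated brackets *)

Section SignSums.
Variables (K : fieldType).

Lemma signz_sum (I : Type) (r : seq I) (P : pred I) (k : int) (F : I -> int) :
  (-1) ^ (k * \sum_(i <- r | P i) F i) = \prod_(i <- r | P i) (-1) ^ (k * F i) :> K.
Proof.
rewrite mulr_sumr; elim/big_rec2: _ => [|i a b _ <-]; first by rewrite expr0z.
exact: signzD.
Qed.

End SignSums.

Section Koszul.
Variables (K : fieldType) (n : nat) (d : 'I_n -> int).
Implicit Types (r : seq 'I_n) (I : {set 'I_n}).

Definition ordlt (a b : 'I_n) : bool := (a < b)%N.

(** The Koszul sign of sorting the list r of indices. *)
Fixpoint inversion_sign r : K :=
  if r is a :: r' then (-1) ^ (d a * \sum_(b <- r' | (b < a)%N) d b) * inversion_sign r' else 1.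

(** The sign of moving the entries of r in I before the others, for r
    increasing; see [unshuffle_signE]. *)
Definition unshuffle_sign r I : K :=
  \prod_(p <- r | p \in I) \prod_(q <- r | (q \notin I) && (q < p)%N) (-1) ^ (d p * d q).

Lemma ordlt_enum : pairwise ordlt (enum 'I_n).
Proof.
rewrite -(pairwise_map val ltn) val_enum_ord -sorted_pairwise; last exact: ltn_trans.
exact: iota_ltn_sorted.
Qed.

Lemma koszul_signE (s : 'S_n) :
  koszul_sign K d s = inversion_sign [seq s a | a <- enum 'I_n].
Proof.
have kosE r : pairwise ordlt r -> inversion_sign [seq s a | a <- r] =
    \prod_(i <- r) \prod_(j <- r | (i < j)%N && (s j < s i)%N) (-1) ^ (d (s i) * d (s j)).
  elim: r => [|a r IH] /=; first by rewrite big_nil.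
  case/andP=> /allP ar hr; rewrite big_cons big_cons ltnn /=; congr (_ * _).
    rewrite big_map signz_sum big_seq_cond [RHS]big_seq_cond; apply: eq_bigl => j.
    by have [/ar|//] := boolP (j \in r); rewrite /ordlt => ->.
  rewrite IH // big_seq [RHS]big_seq; apply: eq_bigr => i /ar.
  rewrite /ordlt => ai; rewrite [RHS]big_cons.
  by rewrite ltnNge (ltnW ai).
rewrite kosE ?ordlt_enum // /koszul_sign big_enum; apply: eq_bigr => i _.
by rewrite big_enum_cond.
Qed.

Lemma inversion_sign_sorted r : pairwise ordlt r -> inversion_sign r = 1.
Proof.
elim: r => //= a r IH /andP[/allP ar /IH ->]; rewrite mulr1 big_seq_cond big1 ?mulr0 //.
by move=> b /andP[/ar]; rewrite /ordlt => ab; rewrite ltnNge (ltnW ab).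
Qed.

Lemma inversion_sign_cat r1 r2 : pairwise ordlt r1 -> pairwise ordlt r2 ->
  inversion_sign (r1 ++ r2) = \prod_(p <- r1) \prod_(q <- r2 | (q < p)%N) (-1) ^ (d p * d q).
Proof.
move=> h1 h2; elim: r1 h1 => [|a r IH] /=; first by rewrite big_nil inversion_sign_sorted.
case/andP=> /allP ar /IH ->; rewrite big_cons big_cat /=; congr (_ * _).
rewrite [X in X + _]big_seq_cond [X in X + _]big1 ?add0r ?signz_sum //.
by move=> b /andP[/ar]; rewrite /ordlt => ab; rewrite ltnNge (ltnW ab).
Qed.

Lemma unshuffle_signE r I : pairwise ordlt r ->
  unshuffle_sign r I = inversion_sign ([seq a <- r | a \in I] ++ [seq a <- r | a \notin I]).
Proof.
move=> hr; rewrite inversion_sign_cat ?pairwise_filter // big_filter; apply: eq_bigr => p _.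
by rewrite big_filter_cond.
Qed.

Lemma unshuffle_sign_rcons r a I : pairwise ordlt (rcons r a) -> I \subset r ->
  unshuffle_sign (rcons r a) I = unshuffle_sign r I.
Proof.
rewrite pairwise_rcons => /andP[/allP ra hr] /fintype.subsetP Ir.
rewrite /unshuffle_sign big_rcons /= ifN; last first.
  by apply/negP => /Ir /ra; rewrite /ordlt ltnn.
rewrite mulr1 big_seq_cond [RHS]big_seq_cond; apply: eq_bigr => p /andP[/ra pa _].
by rewrite big_rcons /= ifN ?mulr1 // ltnNge (ltnW pa) andbF.
Qed.

Lemma unshuffle_sign_rconsU r a I : pairwise ordlt (rcons r a) ->
  unshuffle_sign (rcons r a) (a |: I) =
  unshuffle_sign r I * (-1) ^ (d a * \sum_(q <- r | q \notin I) d q).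
Proof.
rewrite pairwise_rcons => /andP[/allP ra hr].
have aU p : p \in r -> (p \in a |: I) = (p \in I).
  by move=> /ra; rewrite !inE; case: eqP => // ->; rewrite /ordlt ltnn.
rewrite /unshuffle_sign big_rcons /= setU11; congr (_ * _).
  rewrite big_seq_cond [RHS]big_seq_cond; apply: eq_big => [p|p /andP[pr _]].
    by have [/aU|//] := boolP (p \in r).
  rewrite big_rcons /= setU11 mulr1 big_seq_cond [RHS]big_seq_cond.
  by apply: eq_bigl => q; have [/aU ->|//] := boolP (q \in r).
rewrite big_rcons /= setU11 mulr1 signz_sum big_seq_cond [RHS]big_seq_cond.
apply: eq_bigl => q; have [qr|//] := boolP (q \in r).
by have /= := ra _ qr; rewrite aU // /ordlt => ->; rewrite andbT.
Qed.

Lemma big_subset_nil (M : nmodType) (F : {set 'I_n} -> M) :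
  \sum_(I : {set 'I_n} | I \subset [::]) F I = F finset.set0.
Proof.
rewrite (big_pred1 finset.set0) // => I.
apply/idP/eqP => [/fintype.subsetP h|->].
  by apply/setP => b; rewrite inE; apply/negP => /h.
by apply/fintype.subsetP => b; rewrite inE.
Qed.

Lemma big_subset_rcons (M : nmodType) (F : {set 'I_n} -> M) r a : a \notin r ->
  \sum_(I : {set 'I_n} | I \subset rcons r a) F I =
  \sum_(I : {set 'I_n} | I \subset r) (F I + F (a |: I)).
Proof.
move=> ar; rewrite big_split /= addrC.
rewrite (bigID (fun I : {set 'I_n} => a \in I)) /=; congr (_ + _).
  rewrite (reindex_onto (fun I => a |: I) (fun I => I :\ a)) /=; last first.
    by move=> I /andP[_ aI]; rewrite finset.setD1K.
  apply: eq_bigl => I; rewrite setU11 andbT.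
  apply/andP/idP => [[/fintype.subsetP h /eqP IE]|/fintype.subsetP h].
    apply/fintype.subsetP => b bI; have := h b; rewrite !inE mem_rcons inE bI orbT => /(_ isT).
    case/orP=> // /eqP ba; move: bI; rewrite -IE ba !inE eqxx //.
  have aI : a \notin I by apply: contra ar => /h.
  split; last by rewrite setU1K.
  by apply/fintype.subsetP => b; rewrite !inE mem_rcons inE => /orP[->//|/h ->]; rewrite orbT.
apply: eq_bigl => I; apply/andP/idP => [[/fintype.subsetP h aI]|/fintype.subsetP h].
  apply/fintype.subsetP => b bI; have := h b bI; rewrite mem_rcons inE => /orP[/eqP ba|//].
  by rewrite -ba bI in aI.
split; last by apply: contra ar => /h.
by apply/fintype.subsetP => b /h; rewrite mem_rcons inE => ->; rewrite orbT.
Qed.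

End Koszul.

Lemma homogs_image (K : fieldType) (V W : gradedLmodType K) (phi : V -> W) ds s :
  (forall k v, homog k v -> homog k (phi v)) ->
  homogs ds s -> homogs ds [seq phi v | v <- s].
Proof.
by move=> hphi; elim: ds s => [|d ds IH] [|v s] //= [/hphi hv /IH hs].
Qed.

Section FoldedBrackets.
Variables (K : fieldType) (G : gradedLmodType K) (br : G -> G -> G).
Hypothesis brL : graded_lie_bracket br.

Lemma br0l w : br 0 w = 0.
Proof. by have := br_linearl brL w (-1) 0 0; rewrite scaler0 addr0 scaleN1r addNr. Qed.

Lemma br0r w : br w 0 = 0.
Proof. by have := br_linearr brL w (-1) 0 0; rewrite scaler0 addr0 scaleN1r addNr. Qed.

Lemma brZl a u w : br (a *: u) w = a *: br u w.
Proof. by have := br_linearl brL w a u 0; rewrite br0l !addr0. Qed.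

Lemma brZr a u w : br w (a *: u) = a *: br w u.
Proof. by have := br_linearr brL w a u 0; rewrite br0r !addr0. Qed.

Lemma brDl u v w : br (u + v) w = br u w + br v w.
Proof. by have := br_linearl brL w 1 u v; rewrite !scale1r. Qed.

Lemma brDr u v w : br w (u + v) = br w u + br w v.
Proof. by have := br_linearr brL w 1 u v; rewrite !scale1r. Qed.

Lemma brBl u v w : br (u - v) w = br u w - br v w.
Proof. by rewrite -[- v]scaleN1r brDl brZl scaleN1r. Qed.

Lemma brBr u v w : br w (u - v) = br w u - br w v.
Proof. by rewrite -[- v]scaleN1r brDr brZr scaleN1r. Qed.

Lemma br_suml (I : Type) (r : seq I) (P : pred I) (F : I -> G) w :
  br (\sum_(i <- r | P i) F i) w = \sum_(i <- r | P i) br (F i) w.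
Proof. by elim/big_rec2: _ => [|i a b _ <-]; rewrite ?br0l // brDl. Qed.

Lemma foldl_brP a u v s :
  foldl br (a *: u + v) s = a *: foldl br u s + foldl br v s.
Proof. by elim: s u v => //= w s IH u v; rewrite (br_linearl brL) IH. Qed.

Lemma foldl_br0 s : foldl br 0 s = 0.
Proof. by elim: s => //= w s IH; rewrite br0l. Qed.

Lemma foldl_brZ a u s : foldl br (a *: u) s = a *: foldl br u s.
Proof. by rewrite -[a *: u]addr0 foldl_brP foldl_br0 addr0. Qed.

Lemma foldl_br_homog e ds u s : homog e u -> homogs ds s ->
  homog (e + \sum_(k <- ds) k) (foldl br u s).
Proof.
elim: s ds e u => [|v s IH] [|k ds] e u //= hu; first by rewrite big_nil addr0.
by case=> hv hs; rewrite big_cons addrA; apply: IH => //; apply: (br_homog brL).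
Qed.

Variables (n : nat) (d : 'I_n -> int) (x : 'I_n -> G).
Hypothesis hx : forall a, homog (d a) (x a).

Lemma homogs_map (r : seq 'I_n) : homogs (map d r) (map x r).
Proof. by elim: r => //= a r IH; split. Qed.

Lemma foldl_map_homog e u r : homog e u ->
  homog (e + \sum_(a <- r) d a) (foldl br u (map x r)).
Proof. by move=> hu; have := foldl_br_homog hu (homogs_map r); rewrite big_map. Qed.

(** By the Jacobi identity, an argument that commutes with the following ones
    moves past them at the cost of a sign. *)
Lemma foldl_br_move e k u y r : homog e u -> homog k y ->
  (forall a, br y (x a) = 0) ->
  foldl br (br u y) (map x r) =
  (-1) ^ (k * \sum_(a <- r) d a) *: br (foldl br u (map x r)) y.
Proof.
move=> hu hy yx; elim: r e u hu => [|a r IH] e u hu.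
  by rewrite /= big_nil mulr0 expr0z scale1r.
rewrite /= (br_jacobi brL hu hy (hx a)) yx br0r add0r foldl_brZ.
rewrite (IH _ _ (br_homog brL hu (hx a))) scalerA big_cons mulrDr signzD //.
Qed.

(** Once the later arguments are sorted, the first one moves to its place, past
    those of smaller index. *)
Lemma foldl_br_sort (abx : forall a b, br (x a) (x b) = 0) e u r r2 :
  homog e u -> pairwise (@ordlt n) r2 -> perm_eq r r2 ->
  foldl br u (map x r) = inversion_sign K d r *: foldl br u (map x r2).
Proof.
elim: r r2 e u => [|a r IH] r2 e u hu r2s pr.
  by rewrite /= scale1r; move: pr; rewrite perm_sym => /perm_nilP ->.
have ar2 : a \in r2 by rewrite -(perm_mem pr) mem_head.
case/splitPr: ar2 r2s pr => pre post; rewrite pairwise_cat /= => /and3P[].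
move=> /allrelP pp spre /andP[/allP apost spost] pr.
have {}pr : perm_eq r (pre ++ post).
  by rewrite -(perm_cons a) (perm_trans pr) // perm_catC /= perm_cons perm_catC.
rewrite (IH (pre ++ post) _ _ (br_homog brL hu (hx a)) _ pr); last first.
  rewrite pairwise_cat spre spost !andbT; apply/allrelP => b c bp cp.
  by apply: pp => //; rewrite inE cp orbT.
rewrite !map_cat /= !foldl_cat /= (foldl_br_move _ hu (hx a)); last by move=> b.
rewrite foldl_brZ scalerA mulrC; congr ((_ * _) *: _).
rewrite (perm_big _ pr) big_cat /= [X in _ + X]big_seq_cond [X in _ + X]big1 ?addr0.
  rewrite [in RHS]big_seq_cond [in LHS]big_seq; congr (_ ^ (_ * _)).
  apply: eq_bigl => b; have [bp|//] := boolP (b \in pre).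
  by have /(_ b a bp) := pp; rewrite /ordlt => ->; rewrite // mem_head.
by move=> b /andP[/apost]; rewrite /ordlt => ab; rewrite ltnNge (ltnW ab).
Qed.

(** Bracketing with x a is a derivation, so the iterated brackets of a bracket
    expand over the ways of distributing the x a over its two factors. *)
Lemma foldl_br_derivation e f u v r : homog e u -> homog f v -> pairwise (@ordlt n) r ->
  foldl br (br u v) (map x r) =
  \sum_(I : {set 'I_n} | I \subset r)
    (unshuffle_sign K d r I * (-1) ^ (f * \sum_(p <- r | p \in I) d p)) *:
      br (foldl br u (map x [seq a <- r | a \in I]))
         (foldl br v (map x [seq a <- r | a \notin I])).
Proof.
move=> hu hv; elim/last_ind: r => [_|r a IH hr].
  rewrite big_subset_nil.
  by rewrite /= /unshuffle_sign !big_nil mulr0 expr0z mulr1 scale1r.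
have := hr; rewrite pairwise_rcons => /andP[/allP ra hr'].
have ar : a \notin r by apply/negP => /ra; rewrite /ordlt ltnn.
rewrite map_rcons -cats1 foldl_cat /= IH // br_suml big_subset_rcons //.
apply: eq_bigr => I Ir; have /fintype.subsetP Ir' := Ir.
have aI : a \notin I by apply: contra ar => /Ir'.
have aU p : p \in r -> (p \in a |: I) = (p \in I).
  by move=> /ra; rewrite !inE; case: eqP => // ->; rewrite /ordlt ltnn.
rewrite unshuffle_sign_rcons // unshuffle_sign_rconsU // !big_rcons /= (negbTE aI) setU11.
rewrite !filter_rcons (negbTE aI) setU11 /=.
have -> : [seq b <- r | b \in a |: I] = [seq b <- r | b \in I].
  by apply: eq_in_filter => b /aU.
have -> : [seq b <- r | b \notin a |: I] = [seq b <- r | b \notin I].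
  by apply: eq_in_filter => b /aU ->.
have -> : \sum_(p <- r | p \in a |: I) d p = \sum_(p <- r | p \in I) d p.
  rewrite big_seq_cond [RHS]big_seq_cond; apply: eq_bigl => p.
  by have [/aU|//] := boolP (p \in r).
rewrite !map_rcons -!cats1 !foldl_cat /= brZl.
set U := foldl br u _; set W := foldl br v _.
have hU : homog (e + \sum_(b <- [seq b <- r | b \in I]) d b) U by apply: foldl_map_homog.
have hW : homog (f + \sum_(b <- [seq b <- r | b \notin I]) d b) W by apply: foldl_map_homog.
rewrite (br_jacobi brL hU hW (hx a)) scalerDr scalerA addr0 -!mulrA; congr (_ + _ *: _).
congr (_ * _); rewrite -!signzD big_filter; congr (_ ^ _).
ring.
Qed.

End FoldedBrackets.

(** * Shuffles and subsets *)

Section Shuffles.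
Variables (n : nat).
Local Notation e := (enum 'I_n).
Implicit Types (s : 'S_n) (I : {set 'I_n}) (r : seq 'I_n).

Definition parts I : seq 'I_n := [seq a <- e | a \in I] ++ [seq a <- e | a \notin I].

Lemma perm_parts I : perm_eq (parts I) e.
Proof. by apply/permPl; apply: (perm_filterC (mem I)). Qed.

Lemma size_parts I : size (parts I) == n.
Proof. by rewrite (perm_size (perm_parts I)) size_enum_ord. Qed.

Lemma tnth_parts_inj I : injective (tnth (Tuple (size_parts I))).
Proof. by apply/tuple_uniqP; rewrite (perm_uniq (perm_parts I)) enum_uniq. Qed.

Definition shuffle_of I : 'S_n := perm (@tnth_parts_inj I).

Definition firsts i s : {set 'I_n} := [set b in take i [seq s a | a <- e]].

Lemma map_shuffle_of I : [seq shuffle_of I a | a <- e] = parts I.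
Proof.
rewrite -[RHS]/(tval (Tuple (size_parts I))) -map_tnth_enum.
by apply: eq_map => a; rewrite permE.
Qed.

Lemma size_part I : size [seq a <- e | a \in I] = #|I|.
Proof. by rewrite cardE {2}/enum_mem -enumT. Qed.

Lemma ordlt_sorted_eq r1 r2 :
  pairwise (@ordlt n) r1 -> pairwise (@ordlt n) r2 -> r1 =i r2 -> r1 = r2.
Proof.
have tr : transitive (@ordlt n) by move=> b a c; apply: ltn_trans.
rewrite -!(sorted_pairwise tr); apply: irr_sorted_eq => //.
by move=> a; rewrite /ordlt ltnn.
Qed.

Lemma mem_take_enum i (a : 'I_n) : (a \in take i e) = (a < i)%N.
Proof. by rewrite in_take ?mem_enum // index_enum_ord. Qed.

Lemma mem_drop_enum i (a : 'I_n) : (a \in drop i e) = (i <= a)%N.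
Proof.
have : a \in e by rewrite mem_enum.
have : uniq e by apply: enum_uniq.
rewrite -[X in uniq X](cat_take_drop i) -[X in _ \in X -> _](cat_take_drop i).
rewrite cat_uniq mem_cat leqNgt -mem_take_enum => /and3P[_ /hasPn h _].
by have [/h -> //|_] := boolP (a \in drop i e); rewrite orbF => ->.
Qed.

Lemma pairwise_ordlt_map s r : pairwise (@ordlt n) r ->
  pairwise (@ordlt n) [seq s a | a <- r] =
  [forall a, forall b, [&& a \in r, b \in r & a < b]%N ==> (s a < s b)%N].
Proof.
move=> hr; apply/idP/'forall_'forall_implyP.
  elim: r hr => [|c r IH] //= /andP[/allP cr hr] /andP[/allP scr hsr] a b.
  rewrite !inE => /and3P[/orP[/eqP->|ar] /orP[/eqP->|br] ab].
  - by rewrite ltnn in ab.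
  - exact: (scr _ (map_f _ br)).
  - by have := ltn_trans ab (cr _ ar); rewrite ltnn.
  - by apply: IH => //; rewrite ar br.
elim: r hr => [|c r IH] //= /andP[/allP cr hr] h; apply/andP; split.
  apply/allP => _ /mapP[b br ->]; apply: h.
  by rewrite mem_head inE br orbT; apply: cr.
apply: IH => // a b /and3P[ar br ab]; apply: h.
by rewrite !inE ar br !orbT.
Qed.

Lemma is_shuffleE i s :
  is_shuffle i s = pairwise (@ordlt n) (take i [seq s a | a <- e])
                     && pairwise (@ordlt n) (drop i [seq s a | a <- e]).
Proof.
have := ordlt_enum n; rewrite -{1}(cat_take_drop i e) pairwise_cat => /and3P[_ h1 h2].
rewrite -map_take -map_drop !pairwise_ordlt_map //.
apply/idP/andP => [/'forall_'forall_implyP h|].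
  split; apply/'forall_'forall_implyP => a b.
    by rewrite !mem_take_enum => /and3P[_ bi ab]; apply: h; rewrite ab bi.
  by rewrite !mem_drop_enum => /and3P[ai _ ab]; apply: h; rewrite ab ai orbT.
case=> /'forall_'forall_implyP t1 /'forall_'forall_implyP t2.
apply/'forall_'forall_implyP => a b /andP[ab /orP[bi|ai]].
  by apply: t1; rewrite !mem_take_enum (ltn_trans ab bi) bi.
by apply: t2; rewrite !mem_drop_enum ai (leq_trans ai (ltnW ab)).
Qed.

Lemma parts_firsts i s : is_shuffle i s -> parts (firsts i s) = [seq s a | a <- e].
Proof.
rewrite is_shuffleE => /andP[]; set L := map _ _ => h1 h2.
have Lu : uniq L by rewrite map_inj_uniq ?enum_uniq //; apply: perm_inj.
have Le b : b \in L by apply/mapP; exists (s^-1%g b); rewrite ?mem_enum ?permKV.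
rewrite -(cat_take_drop i L) /parts; congr (_ ++ _); apply: ordlt_sorted_eq => //.
- by rewrite pairwise_filter // ordlt_enum.
- by move=> b; rewrite mem_filter mem_enum andbT inE.
- by rewrite pairwise_filter // ordlt_enum.
move=> b; rewrite mem_filter mem_enum andbT inE.
have := Le b; rewrite -(cat_take_drop i L) in Lu *; move: Lu.
rewrite cat_uniq mem_cat cat_take_drop => /and3P[_ /hasPn h _].
by have [bd _|_] := boolP (b \in drop i L); [exact: h | rewrite orbF => ->].
Qed.

Lemma shuffle_ofK i s : is_shuffle i s -> shuffle_of (firsts i s) = s.
Proof.
move=> hs; apply/permP => a; apply/eqP.
have := map_shuffle_of (firsts i s); rewrite parts_firsts // => /eq_in_map h.
by rewrite h // mem_enum.
Qed.

Lemma shuffle_of_shuffle i I : (i <= n)%N ->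
  is_shuffle i (shuffle_of I) && (firsts i (shuffle_of I) == I) = (#|I| == i).
Proof.
move=> le_in; rewrite is_shuffleE /firsts map_shuffle_of.
apply/andP/eqP => [[_ /eqP <-]|cI].
  rewrite cardsE (card_uniqP _) ?size_take ?(eqP (size_parts I)).
    by case: ltngtP le_in.
  by rewrite take_uniq // (perm_uniq (perm_parts I)) enum_uniq.
rewrite /parts take_size_cat ?drop_size_cat ?size_part //.
have he (P : pred 'I_n) : pairwise (@ordlt n) (filter P e).
  exact/pairwise_filter/ordlt_enum.
rewrite !he; split=> //.
by apply/eqP/setP => b; rewrite inE mem_filter mem_enum andbT.
Qed.

(** An (i, n - i)-shuffle is determined by its set of first i values, which
    is an arbitrary set of size i; its inversions are the pairs q < p with p
    in this set and q outside of it. *)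
Lemma sum_shuffles (K : fieldType) (M : lmodType K) (T : Type) (d : 'I_n -> int)
    (x : 'I_n -> T) (F : seq T -> seq T -> M) i : (i <= n)%N ->
  \sum_(s : 'S_n | is_shuffle i s)
    koszul_sign K d s *: F (take i (perm_seq x s)) (drop i (perm_seq x s)) =
  \sum_(I : {set 'I_n} | #|I| == i) unshuffle_sign K d e I *:
    F [seq x a | a <- [seq a <- e | a \in I]] [seq x a | a <- [seq a <- e | a \notin I]].
Proof.
move=> le_in; rewrite (reindex_onto shuffle_of (firsts i)); last first.
  exact: shuffle_ofK.
apply: eq_big => [I|I]; first exact: shuffle_of_shuffle.
rewrite shuffle_of_shuffle // => /eqP cI.
rewrite koszul_signE map_shuffle_of unshuffle_signE ?ordlt_enum //.
have -> : perm_seq x (shuffle_of I) = [seq x a | a <- parts I].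
  by rewrite -map_shuffle_of -map_comp.
rewrite -map_take -map_drop take_size_cat ?drop_size_cat ?size_part //.
Qed.

End Shuffles.

(** * Higher derived brackets *)

Lemma sum_by_card (M : nmodType) (n : nat) (F : {set 'I_n} -> M) :
  \sum_(1 <= i < n.+1) \sum_(I : {set 'I_n} | #|I| == i) F I =
  \sum_(I : {set 'I_n} | I != finset.set0) F I.
Proof.
rewrite (exchange_big_dep xpredT) //= [RHS]big_mkcond; apply: eq_bigr => I _.
rewrite (eq_bigl (fun i => i == #|I|)) => [|i]; last exact: eq_sym.
have In : (#|I| <= n)%N by have := max_card (mem I); rewrite card_ord.
by rewrite big_nat1_eq ltnS In andbT card_gt0.
Qed.

Lemma inversion_sign_sq (K : fieldType) (n : nat) (d : 'I_n -> int) r :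
  inversion_sign K d r * inversion_sign K d r = 1.
Proof. by elim: r => [|a r IH] /=; rewrite ?mulr1 // mulrACA IH mulr1 signz_sq. Qed.

(** The inversions of I and those of its complement make up all the pairs with
    one element in each. *)
Lemma unshuffle_signC (K : fieldType) (n : nat) (d : 'I_n -> int) (I : {set 'I_n}) :
  unshuffle_sign K d (enum 'I_n) (~: I) = unshuffle_sign K d (enum 'I_n) I *
    (-1) ^ ((\sum_(a in I) d a) * \sum_(a in ~: I) d a).
Proof.
pose F (p q : 'I_n) : K := (-1) ^ (d p * d q).
have E J : unshuffle_sign K d (enum 'I_n) J =
    \prod_(p in J) \prod_(q | (q \notin J) && (q < p)%N) F p q.
  rewrite /unshuffle_sign big_enum_cond; apply: eq_big => [//|p _].
  by rewrite big_enum_cond.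
have -> : (-1) ^ ((\sum_(a in I) d a) * \sum_(a in ~: I) d a) =
    \prod_(p in I) \prod_(q | q \notin I) F p q.
  rewrite mulrC signz_sum; apply: eq_bigr => p _; rewrite mulrC signz_sum.
  by apply: eq_bigl => q; rewrite inE.
rewrite !E (exchange_big_dep (mem I)) /=; last first.
  by move=> p q _; rewrite !inE negbK => /andP[].
rewrite -big_split; apply: eq_bigr => q qI /=.
rewrite [X in _ * X](bigID (fun p : 'I_n => (p < q)%N)) /= mulrA -big_split /=.
rewrite [X in _ = X * _]big1 ?mul1r => [|p _]; last exact: signz_sq.
apply: eq_big => [p|p _]; last by rewrite /F mulrC.
rewrite !inE qI /=; have [->|pq] := eqVneq p q; first by rewrite qI.
by rewrite -leqNgt [in RHS]leq_eqVlt (inj_eq (@ord_inj n)) [q == p]eq_sym (negbTE pq).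
Qed.

(** Voronov's V-data, where H is embedded in G by inc. *)
Record V_data (K : fieldType) (G H : gradedLmodType K) (br : G -> G -> G)
    (inc : {linear H -> G}) (P : {linear G -> H}) (pi : G) : Prop := VData {
  V_lie : graded_lie_bracket br;
  V_inc_homog : forall n f, homog n f -> homog n (inc f);
  V_P_homog : forall n u, homog n u -> homog n (P u);
  V_incK : cancel inc P;
  V_abelian : forall n m f g, homog n f -> homog m g -> br (inc f) (inc g) = 0;
  V_ker : forall n m u v, homog n u -> homog m v -> P u = 0 -> P v = 0 -> P (br u v) = 0;
  V_pi_homog : homog (-1) pi;
  V_pi_sq : br pi pi = 0;
  V_pi_ker : P pi = 0
}.

Section Voronov.
Variables (K : fieldType) (G H : gradedLmodType K) (br : G -> G -> G).
Variables (inc : {linear H -> G}) (P : {linear G -> H}) (pi : G).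
Hypothesis V : V_data br inc P pi.
Hypothesis charK2 : (2 : K) != 0.

Let brL := V_lie V.

Definition derived (fs : seq H) : H :=
  if fs is [::] then 0 else P (foldl br pi (map inc fs)).

Lemma derivedE fs : (0 < size fs)%N -> derived fs = P (foldl br pi (map inc fs)).
Proof. by case: fs. Qed.

Lemma derived_inC : inC (-1) derived.
Proof.
split; first split=> // [s t a u v].
  rewrite !derivedE ?size_cat ?addnS // !map_cat !foldl_cat /= linearP /=.
  by rewrite (br_linearr brL) (foldl_brP brL) linearP.
move=> ds [|f fs]; first by move=> _; apply: homog0.
move=> h; rewrite derivedE //; apply: (V_P_homog V).
apply: (foldl_br_homog brL (V_pi_homog V)).
exact: (homogs_image (V_inc_homog V)).
Qed.

Definition derived_cochain : cochain H H := Cochain (sumC_inC derived_inC).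

(** Decompose u and v along inc H and ker P: the bracket of the parts in inc H
    vanishes, and P kills the bracket of the parts in ker P. *)
Lemma P_bracket n m u v : homog n u -> homog m v ->
  P (br u v) = P (br (inc (P u)) v) + P (br u (inc (P v))).
Proof.
move=> hu hv.
have kerP w : P (w - inc (P w)) = 0 by rewrite linearB /= (V_incK V) subrr.
have hker k w : homog k w -> homog k (w - inc (P w)).
  by move=> hw; apply: homogB => //; apply/(V_inc_homog V)/(V_P_homog V).
have := V_ker V (hker _ _ hu) (hker _ _ hv) (kerP u) (kerP v).
rewrite !(brBl brL, brBr brL) (V_abelian V (V_P_homog V hu) (V_P_homog V hv)).
rewrite subr0 !linearB /=.
by move/eqP; rewrite subr_eq0 subr_eq addrC => /eqP.
Qed.

Lemma derived_symmetric (n : nat) (d : 'I_n -> int) (x : 'I_n -> H) (s : 'S_n) :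
  (forall a, homog (d a) (x a)) ->
  derived [seq x a | a <- enum 'I_n] = koszul_sign K d s *: derived (perm_seq x s).
Proof.
move=> hx; case: n => [|n] in d x s hx *.
  have e0 : enum 'I_0 = [::] by apply/nilP; rewrite /nilp size_enum_ord.
  by rewrite /perm_seq e0 /= scaler0.
have sz (y : 'I_n.+1 -> H) : (0 < size [seq y a | a <- enum 'I_n.+1])%N.
  by rewrite size_map size_enum_ord.
rewrite /perm_seq !derivedE // koszul_signE.
have -> : [seq x (s a) | a <- enum 'I_n.+1] =
    [seq x a | a <- [seq s a | a <- enum 'I_n.+1]].
  by rewrite -[RHS]map_comp.
rewrite -!(map_comp inc x).
rewrite (foldl_br_sort brL (fun a => V_inc_homog V (hx a)) _ (V_pi_homog V) (ordlt_enum _)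
           (r := [seq s a | a <- _])).
- by rewrite linearZ /= scalerA inversion_sign_sq scale1r.
- by move=> a b; apply: (V_abelian V (hx a) (hx b)).
apply: uniq_perm; rewrite ?enum_uniq ?(map_inj_uniq perm_inj) ?enum_uniq //.
by move=> a; rewrite mem_enum; apply/mapP; exists (s^-1%g a); rewrite ?mem_enum ?permKV.
Qed.

(** Expand P[..[[pi, pi], x1].., xn] = 0 over the subsets of the arguments; the
    terms of the relation appear twice, whence the division by 2. *)
Lemma derived_jacobi (n : nat) (d : 'I_n -> int) (x : 'I_n -> H) :
  (0 < n)%N -> (forall a, homog (d a) (x a)) ->
  \sum_(1 <= i < n.+1) \sum_(s : 'S_n | is_shuffle i s)
    koszul_sign K d s *:
      derived (derived (take i (perm_seq x s)) :: drop i (perm_seq x s)) = 0.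
Proof.
move=> n_gt0 hx; set e := enum 'I_n; pose X a := inc (x a).
have hX a : homog (d a) (X a) := V_inc_homog V (hx a).
pose D (I : {set 'I_n}) := foldl br pi [seq X a | a <- [seq a <- e | a \in I]].
pose deg (I : {set 'I_n}) := \sum_(a in I) d a.
pose sg (I : {set 'I_n}) : K := unshuffle_sign K d e I.
pose theta I := P (br (inc (P (D I))) (D (~: I))).
have DC I : D (~: I) = foldl br pi [seq X a | a <- [seq a <- e | a \notin I]].
  by rewrite /D; congr (foldl br pi (map X _)); apply: eq_filter => a; rewrite inE.
have hD I : homog (-1 + deg I) (D I).
  have := foldl_map_homog brL hX [seq a <- e | a \in I] (V_pi_homog V).
  by rewrite big_filter big_enum_cond.
have hPD I : homog (-1 + deg I) (inc (P (D I))).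
  exact/(V_inc_homog V)/(V_P_homog V).
have theta_sum : \sum_I (sg I * (-1) ^ deg I) *: theta I = 0.
  (* The terms where P is applied to the second factor, after exchanging I and
     its complement. *)
  have E I : (sg (~: I) * (-1) ^ deg (~: I)) *: P (br (D (~: I)) (inc (P (D I)))) =
             (sg I * (-1) ^ deg I) *: theta I.
    rewrite (br_antisym brL (hD _) (hPD _)) /sg unshuffle_signC -scaleN1r scalerA.
    rewrite linearZ /= scalerA.
    rewrite -[X in X * (-1) ^ ((-1 + _) * _)]expr1z -!mulrA -!signzD.
    congr (_ * _ *: _); apply: (@signz_parity _ (deg I * deg (~: I) - deg I + 1)).
    by rewrite /deg; ring.
  have := foldl_br_derivation brL hX (V_pi_homog V) (V_pi_homog V) (ordlt_enum n).
  rewrite (V_pi_sq V) (foldl_br0 brL) => /(congr1 P).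
  rewrite linear0 linear_sum /=.
  rewrite (eq_bigl xpredT) => [|I]; last first.
    by apply/fintype.subsetP => a _; rewrite mem_enum.
  rewrite (eq_bigr (fun I => (sg I * (-1) ^ deg I) *: theta I +
      (sg I * (-1) ^ deg I) *: P (br (D I) (inc (P (D (~: I))))))) => [|I _]; last first.
    rewrite -DC linearZ /= (P_bracket (hD I) (hD (~: I))) big_enum_cond -scalerDr.
    congr (_ * _ *: _); apply: (@signz_parity _ (- deg I)).
    by rewrite /deg; ring.
  rewrite big_split /= [X in _ + X](reindex_inj (inv_inj (@finset.setCK _))) /=.
  under [X in _ + X]eq_bigr => I _ do rewrite finset.setCK E.
  (* Both halves of the sum are now equal. *)
  rewrite -mulr2n -scaler_nat => /esym/eqP; rewrite scaler_eq0 (negbTE charK2).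
  by move/eqP.
(* T I collects the terms of the relation given by the set I; for I empty it
   vanishes because P pi = 0. *)
pose T I := sg I *: P (foldl br (br pi (inc (P (D I))))
  [seq X a | a <- [seq a <- e | a \notin I]]).
have TE I : T I = (sg I * (-1) ^ deg I) *: theta I.
  rewrite /T (foldl_br_move brL hX _ (V_pi_homog V) (hPD I)); last first.
    by move=> a; apply: (V_abelian V (V_P_homog V (hD I)) (hx a)).
  rewrite -DC (br_antisym brL (hD _) (hPD _)) big_filter -scaleN1r !scalerA linearZ /=.
  rewrite scalerA -[X in _ * X * _]expr1z -!mulrA -!signzD.
  have -> : \sum_(a <- e | a \notin I) d a = deg (~: I).
    by rewrite /deg big_enum_cond; apply: eq_bigl => a; rewrite [RHS]inE.
  congr (_ * _ *: _).
  apply: (@signz_parity _ ((deg I - 1) * deg (~: I) - deg I + 1)).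
  by ring.
transitivity (\sum_(1 <= i < n.+1) \sum_(I : {set 'I_n} | #|I| == i) T I).
  apply: eq_big_nat => i /andP[i_gt0 i_le].
  rewrite (sum_shuffles d x (fun s t => derived (derived s :: t))) //.
  apply: eq_bigr => I /eqP cI; congr (_ *: _).
  by rewrite !derivedE ?size_map ?size_part ?cI //= -!map_comp.
rewrite sum_by_card -[RHS]theta_sum [RHS](bigD1 finset.set0) //=.
rewrite -TE {2}/T /D.
have -> : [seq a <- e | a \in finset.set0] = [::].
  by rewrite (eq_filter (a2 := pred0)) ?filter_pred0 // => a; rewrite inE.
rewrite /= (V_pi_ker V) linear0 (br0r brL) (foldl_br0 brL) linear0 scaler0 add0r.
by apply: eq_bigr => I _; apply: TE.
Qed.

Theorem derived_Linf : exists l : Linf H,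
  forall fs : seq H, (0 < size fs)%N -> l fs = P (foldl br pi (map inc fs)).
Proof.
exists (@Build_Linf K H derived_cochain derived_inC derived_symmetric derived_jacobi).
exact: derivedE.
Qed.

End Voronov.

(** * The V-data of an A-infinity algebra *)

Section AinfData.
Variables (K : fieldType) (A : gradedLmodType K).
Local Notation V := (A * A)%type.
Local Notation G := (cochain V V).
Local Notation H := (cochain A A).

Lemma inclH_is_linear : linear (@inclH K A).
Proof.
move=> a f g; apply: cochain_eqP; apply/funext => s.
by apply/pair_equal_spec; rewrite /= scaler0 addr0.
Qed.

HB.instance Definition _ := GRing.isLinear.Build K H G *:%R (@inclH K A) inclH_is_linear.

Lemma projH_is_linear : linear (@projH K A).
Proof. by move=> a f g; apply: cochain_eqP. Qed.

HB.instance Definition _ := GRing.isLinear.Build K G H *:%R (@projH K A) projH_is_linear.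

Lemma inclHK : cancel (@inclH K A) (@projH K A).
Proof.
move=> f; apply: cochain_eqP; apply/funext => s.
by rewrite /= /proj_fun /incl_fun /= -map_comp map_id.
Qed.

(** The output of inclH g has no component in the only summand that inclH f
    reads. *)
Lemma inclH_diamond m (f g : H) : homog m g -> diamond (inclH f) (inclH g) = 0.
Proof.
move=> hg; apply: cochain_eqP; rewrite (@diamond_homE _ _ m); last exact: incl_inC.
apply/funext => s; rewrite /diamond_deg big1 // => l _; rewrite big1 // => i _.
rewrite /= /incl_fun map_cat /= multilinear_zero //; exact: cochain_multilinear.
Qed.

Lemma inclH_abelian n m (f g : H) :
  homog n f -> homog m g -> bracket (inclH f) (inclH g) = 0.
Proof.
move=> hf hg; rewrite (@bracketE _ _ _ _ n m); try exact: incl_inC.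
by rewrite (inclH_diamond f hg) (inclH_diamond g hf) scaler0 subr0.
Qed.

(** A cochain is killed by P when it maps lists over the first summand into
    the first summand, a property that insertions preserve. *)
Lemma projH_diamond m (u v : G) : homog m v ->
  projH u = 0 -> projH v = 0 -> projH (diamond u v) = 0.
Proof.
move=> hv u0 v0; have j0 (w : G) t : projH w = 0 -> (w [seq (a, 0) | a <- t]).2 = 0.
  by move=> w0; rewrite -[LHS]/(projH w t) w0.
apply: cochain_eqP; apply: multilinear_homog_eq0 => [|ds s hs].
  exact: cochain_multilinear.
have hjs : homogs ds [seq ((a, 0) : V) | a <- s].
  by apply: homogs_image hs => k a ha; split=> //; apply: homog0.
rewrite -[LHS]/(diamond u v [seq (a, 0) | a <- s]).2 (diamondE _ hv hjs) snd_sum.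
rewrite big1 // => l _; rewrite snd_sum big1 // => i _ /=.
rewrite -!map_take -!map_drop -!map_take.
set t := take l _; have -> : v [seq (a, 0) | a <- t] = ((v [seq (a, 0) | a <- t]).1, 0).
  by rewrite [LHS]surjective_pairing (j0 v t v0).
by rewrite -map_cons -map_cat j0 // scaler0.
Qed.

Lemma projH_bracket n m (u v : G) : homog n u -> homog m v ->
  projH u = 0 -> projH v = 0 -> projH (bracket u v) = 0.
Proof.
move=> hu hv u0 v0; rewrite (bracketE hu hv) linearB linearZ /=.
by rewrite (projH_diamond hv) // (projH_diamond hu) // scaler0 subr0.
Qed.

Lemma nth_map_ord (k : nat) (g : 'I_k -> A) (i : 'I_k) :
  [seq g a | a <- enum 'I_k]`_i = g i.
Proof. by rewrite (nth_map i) ?size_enum_ord // nth_ord_enum. Qed.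

Lemma multilinear_map_ordD f (k : nat) (w1 w2 w3 : 'I_k -> A) (a : 'I_k) :
  @multilinear K A A f -> (forall i, i != a -> w1 i = w2 i /\ w1 i = w3 i) ->
  w1 a = w2 a + w3 a ->
  f [seq w1 i | i <- enum 'I_k] =
  f [seq w2 i | i <- enum 'I_k] + f [seq w3 i | i <- enum 'I_k].
Proof.
move=> fm wi wa; rewrite -[f (map w2 _)]scale1r.
have sz (w : 'I_k -> A) : size [seq w i | i <- enum 'I_k] = k.
  by rewrite size_map size_enum_ord.
apply: (multilinear_nthE (j := a)) => //; rewrite ?sz //.
  move=> i ia; have [ik|ki] := ltnP i k.
    rewrite -[i]/(val (Ordinal ik)) !nth_map_ord.
    by apply: wi; apply: contraNneq ia => <-.
  by rewrite !nth_default ?sz.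
by rewrite !nth_map_ord scale1r.
Qed.

Lemma multilinear_expand f (k : nat) (u v : 'I_k -> A) : @multilinear K A A f ->
  f [seq u i + v i | i <- enum 'I_k] =
  \sum_(I : {set 'I_k}) f [seq if i \in I then v i else u i | i <- enum 'I_k].
Proof.
move=> fm.
have H r : uniq r -> forall u : 'I_k -> A,
    f [seq if i \in r then u i + v i else u i | i <- enum 'I_k] =
    \sum_(I : {set 'I_k} | I \subset r)
      f [seq if i \in I then v i else u i | i <- enum 'I_k].
  (* The slots of r are expanded one by one; for slot a, u' carries v a as its
     value there, so that the induction hypothesis covers both summands. *)
  elim/last_ind: r => [_ {}u|r a IH].
    rewrite big_subset_nil.
    by congr f; apply: eq_map => i; rewrite in_nil inE.
  rewrite rcons_uniq => /andP[ar ur] {}u; rewrite big_subset_rcons // big_split /=.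
  pose u' i := if i == a then v a else u i.
  rewrite (@multilinear_map_ordD _ _ _ (fun i => if i \in r then u i + v i else u i)
    (fun i => if i \in r then u' i + v i else u' i) a) //.
  - rewrite IH // IH //; congr (_ + _); apply: eq_bigr => I /fintype.subsetP Ir.
    congr f; apply: eq_map => i; rewrite !inE /u'.
    by case: eqP => [->|//]; rewrite if_same.
  - by move=> i /negbTE ia; rewrite mem_rcons inE /u' ia.
  - by rewrite mem_rcons inE eqxx (negbTE ar) /u' eqxx.
have := H _ (enum_uniq 'I_k) u; rewrite (eq_bigl xpredT) => [<-|I].
  by congr f; apply: eq_map => i; rewrite mem_enum.
by apply/fintype.subsetP => i _; rewrite mem_enum.
Qed.

Variable mu : Ainf A.
Local Notation pi := (pi_Ainf mu).

(** The term mu(a_1, ..., a_k) is the missing summand I = set0 of the expansion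
    of mu(a_1 + x_1, ..., a_k + x_k). *)
Lemma pi_add s : (pi s).1 + (pi s).2 = mu [seq p.1 + p.2 | p <- s].
Proof.
have mum := cochain_multilinear mu.
have sE (g : V -> A) : [seq g p | p <- s] = [seq g s`_(val i) | i <- enum 'I_(size s)].
  by rewrite -[in LHS](mkseq_nth 0 s) /mkseq -val_enum_ord -!map_comp.
rewrite sE multilinear_expand // (bigD1 finset.set0) //= /pi_snd sum_by_card sE.
by congr (mu _ + _); apply: eq_map => i; rewrite inE.
Qed.

Lemma projH_pi : projH pi = 0.
Proof.
apply: cochain_eqP; apply/funext => s; rewrite -[LHS]/(pi [seq (a, 0) | a <- s]).2.
apply: (addrI (pi [seq (a, 0) | a <- s]).1); rewrite pi_add -[RHS]/(_ + 0) addr0 /=.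
by congr (mu _); rewrite -!map_comp; apply: eq_map => a /=; rewrite addr0.
Qed.

(** A strict morphism from pi to mu sends the square of pi to that of mu, which
    is zero by the A-infinity relations. *)
Lemma strict_pi_sq (phi : V -> A) ds s :
  (forall a u v, phi (a *: u + v) = a *: phi u + phi v) ->
  (forall k v, homog k v -> homog k (phi v)) ->
  (forall t, phi (pi t) = mu [seq phi p | p <- t]) ->
  homogs ds s -> phi (diamond pi pi s) = 0.
Proof.
move=> phiP phi_homog phi_pi hs.
have phi0 : phi 0 = 0.
  by have := phiP (-1) 0 0; rewrite scaler0 addr0 scaleN1r addNr.
have phiZ a u : phi (a *: u) = a *: phi u by rewrite -[a *: u]addr0 phiP phi0 addr0.
have phi_sum (r : seq nat) F : phi (\sum_(i <- r) F i) = \sum_(i <- r) phi (F i).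
  by elim/big_rec2: _ => [//|i x y _ <-]; rewrite -[F i]scale1r phiP !scale1r.
have hpi : homog (-1) pi := pi_inC mu.
case: s => [|p s] in hs *.
  by rewrite (diamond_homE _ hpi) diamond_deg_nil.
have hphi := homogs_image phi_homog hs.
rewrite (diamondE _ hpi hs) phi_sum.
rewrite -[RHS](Ainf_relation mu _ hphi) ?size_map //.
apply: eq_bigr => l _; rewrite phi_sum; apply: eq_bigr => i _.
rewrite phiZ phi_pi map_cat map_cons phi_pi !map_take !map_drop; congr (_ *: _).
by apply: (@signz_parity _ (- \sum_(k <- take i ds) k)); ring.
Qed.

(** The maps (a, x) |-> a and (a, x) |-> a + x are strict morphisms and together
    determine an element. *)
Lemma pi_sq : bracket pi pi = 0.
Proof.
have hpi : homog (-1) pi := pi_inC mu.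
suff dd : diamond pi pi = 0 by rewrite (bracketE hpi hpi) dd scaler0 subr0.
apply: cochain_eqP; apply: multilinear_homog_eq0 => [|ds s hs].
  exact: cochain_multilinear.
have h1 : (diamond pi pi s).1 = 0.
  by apply: (strict_pi_sq (phi := fst)) hs => // k v [].
have h2 : (diamond pi pi s).1 + (diamond pi pi s).2 = 0.
  apply: (strict_pi_sq (phi := fun p => p.1 + p.2)) hs => [a u v|k v [hv1 hv2]|t].
  - by rewrite /= scalerDr addrACA.
  - exact: homogD.
  - exact: pi_add.
by rewrite [LHS]surjective_pairing h1; move: h2; rewrite h1 add0r => ->.
Qed.

Lemma Ainf_V_data : V_data (@bracket K V) (@inclH K A) (@projH K A) pi.
Proof.
split.
- exact: bracket_graded_lie.
- by move=> n f; apply: incl_inC.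
- by move=> n f; apply: proj_inC.
- exact: inclHK.
- exact: inclH_abelian.
- exact: projH_bracket.
- exact: pi_inC.
- exact: pi_sq.
- exact: projH_pi.
Qed.

End AinfData.

Theorem theorem4p5 (K : fieldType) (charK0 : [pchar K] =i pred0)
    (A : gradedLmodType K) (mu : Ainf A) :
  exists l : Linf (cochain A A),
    forall (ns : seq int) (fs : seq (cochain A A)),
      (0 < size fs)%N -> homogs ns fs ->
      l fs = projH (foldl (@bracket K (A * A)%type) (pi_Ainf mu) [seq inclH f | f <- fs]).
Proof.
have charK2 : (2 : K) != 0 by have /pcharf0P -> := charK0.
have [l lE] := derived_Linf (Ainf_V_data mu) charK2.
by exists l => ns fs fs_gt0 _; apply: lE.
Qed.
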